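(* Let $\Omega\in\{\Omega_A,\Omega_B,\Omega_C\}$. Then the three elements \[ \alpha,\qquad \beta,\qquad 256\,\Omega+3(4\delta-3)(4\delta+1) \] generate the two-sided ideal $\ker\sharp$ of $\Re$, and they form a minimal generating set: no one of them lies in the two-sided ideal of $\Re$ generated by the other two.
   Context: All algebras are unital associative over $\mathbb C$, $[x,y]=xy-yx$, $\mathbf i=\sqrt{-1}$. $U(\mathfrak{sl}_2)$ is generated by $E,F,H$ with $[H,E]=2E$, $[H,F]=-2F$, $[E,F]=H$; $\Lambda=EF+FE+\frac{H^2}{2}$. $\Re$ is generated by $A,B,C,\Delta$ with $[A,B]=[B,C]=[C,A]=2\Delta$ and with $\alpha=[A,\Delta]+AC-BA$, $\beta=[B,\Delta]+BA-CB$, $\gamma=[C,\Delta]+CB-AC$ central; $\delta=A+B+C$ (central). The Casimir elements are $\Omega_A=\Delta^2+\tfrac{BAC+CAB}{2}+A^2+B\gamma-C\beta-A\delta$, $\Omega_B=\Delta^2+\tfrac{CBA+ABC}{2}+B^2+C\alpha-A\gamma-B\delta$, $\Omega_C=\Delta^2+\tfrac{ACB+BCA}{2}+C^2+A\beta-B\alpha-C\delta$ (central in $\Re$). $\sharp:\Re\to U(\mathfrak{sl}_2)$ is the unique algebra homomorphism with $A\mapsto \frac{(E+F-2)(E+F+2)}{16}$, $B\mapsto\frac{(H-2)(H+2)}{16}$, $C\mapsto\frac{(\mathbf iE-\mathbf iF-2)(\mathbf iE-\mathbf iF+2)}{16}$, $\Delta\mapsto\frac{(H+2)F^2-(H-2)E^2}{64}$.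 *)

(* Defs.v *)
From mathcomp Require Import all_boot all_algebra.
From mathcomp Require Import reals finmap.
From mathcomp.real_closed Require Export complex.
From mathcomp.multinomials Require Export monalg.
Set Implicit Arguments.
Unset Strict Implicit.
Unset Printing Implicit Defensive.
Import GRing.Theory Num.Theory.
Local Open Scope ring_scope.

Section Racah.
Variable R : realType.

Definition CC := R[i].

(* The free associative unital C-algebra on n generators, i.e. the monoid
   algebra of the free monoid on 'I_n. *)
Definition FA (n : nat) := {malg CC[{fmonom 'I_n}]}.

Definition gen (n : nat) (i : 'I_n) : FA n := << fmu i >>.

(* The unique unital C-algebra morphism FA n -> FA m sending generator i to v i. *)
Definition fa_subst (n m : nat) (v : 'I_n -> FA m) (x : FA n) : FA m :=
  \sum_(w <- msupp x) (x@_w) *: \prod_(i <- fmonom_val w) v i.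

Definition comm (T : ringType) (x y : T) : T := x * y - y * x.

Definition in_ideal (T : ringType) (S : T -> Prop) (x : T) : Prop :=
  exists t : seq (T * T * T),
    (forall p, p \in t -> S p.1.2) /\
    x = \sum_(p <- t) p.1.1 * p.1.2 * p.2.

Definition rA : FA 4 := gen (@Ordinal 4 0 isT).
Definition rB : FA 4 := gen (@Ordinal 4 1 isT).
Definition rC : FA 4 := gen (@Ordinal 4 2 isT).
Definition rD : FA 4 := gen (@Ordinal 4 3 isT).

Definition ralpha : FA 4 := comm rA rD + rA * rC - rB * rA.
Definition rbeta  : FA 4 := comm rB rD + rB * rA - rC * rB.
Definition rgamma : FA 4 := comm rC rD + rC * rB - rA * rC.
Definition rdelta : FA 4 := rA + rB + rC.

Definition half : CC := (2%:R : CC)^-1.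

Definition OmegaA : FA 4 :=
  rD ^+ 2 + half *: (rB * rA * rC + rC * rA * rB) + rA ^+ 2
  + rB * rgamma - rC * rbeta - rA * rdelta.
Definition OmegaB : FA 4 :=
  rD ^+ 2 + half *: (rC * rB * rA + rA * rB * rC) + rB ^+ 2
  + rC * ralpha - rA * rgamma - rB * rdelta.
Definition OmegaC : FA 4 :=
  rD ^+ 2 + half *: (rA * rC * rB + rB * rC * rA) + rC ^+ 2
  + rA * rbeta - rB * ralpha - rC * rdelta.

Definition racah_rel (x : FA 4) : Prop :=
  x = comm rA rB - 2%:R * rD \/
  x = comm rB rC - 2%:R * rD \/
  x = comm rC rA - 2%:R * rD \/
  (exists g : 'I_4, x = comm ralpha (gen g) \/ x = comm rbeta (gen g)
                    \/ x = comm rgamma (gen g)).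

Definition uE : FA 3 := gen (@Ordinal 3 0 isT).
Definition uF : FA 3 := gen (@Ordinal 3 1 isT).
Definition uH : FA 3 := gen (@Ordinal 3 2 isT).

Definition sl2_rel (x : FA 3) : Prop :=
  x = comm uH uE - 2%:R * uE \/
  x = comm uH uF + 2%:R * uF \/
  x = comm uE uF - uH.

Definition sc (c : CC) : FA 3 := c *: 1.

Definition sharp_gen (i : 'I_4) : FA 3 :=
  match val i with
  | 0 => (16%:R : CC)^-1 *: ((uE + uF - 2%:R) * (uE + uF + 2%:R))
  | 1 => (16%:R : CC)^-1 *: ((uH - 2%:R) * (uH + 2%:R))
  | 2 => (16%:R : CC)^-1 *:
           ((sc 'i * uE - sc 'i * uF - 2%:R) * (sc 'i * uE - sc 'i * uF + 2%:R))
  | _ => (64%:R : CC)^-1 *: ((uH + 2%:R) * uF ^+ 2 - (uH - 2%:R) * uE ^+ 2)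
  end.

(* lift of sharp to the free algebra on A, B, C, Delta *)
Definition sharp (x : FA 4) : FA 3 := fa_subst sharp_gen x.

(* x (a lift of an element of Re) lies in ker sharp iff sharp x is 0 in U(sl2) *)
Definition in_ker_sharp (x : FA 4) : Prop := in_ideal sl2_rel (sharp x).

Definition omega_elt (Om : FA 4) : FA 4 :=
  256%:R * Om + 3%:R * ((4%:R * rdelta - 3%:R) * (4%:R * rdelta + 1)).

End Racah.

(* Main.v *)
(** Let I be the ideal generated by the Racah relations together with alpha,
    beta and w. Modulo I the element delta = A + B + C is central and the words
    delta^i B^j Delta^l A^k with l <= 1 span: A and Delta can be moved to the
    right past B at the cost of words of the same shape, and w = 0 eliminates
    Delta^2.  On the other side U(sl2) acts on functions g of a complex variable
    by difference operators depending on a parameter lambda,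
      (E g)(s) = g(s + 1), (F g)(s) = (lambda - s^2) g(s - 1),
      (H g)(s) = -(2 s + 1) g(s).
    Through [sharp], delta acts by a scalar affine in lambda, B by
    multiplication by ((2s + 1)^2 - 4) / 16, while the leading shifts of A and
    Delta are constant * g(s + 2) and constant * (2s + 3) g(s + 2). Comparing
    leading shifts, and separating even from odd functions of s + 1/2, shows that
    the spanning words have linearly independent images; hence the kernel of
    [sharp] is I.  Minimality is witnessed by one-dimensional representations
    in which Delta = 0. *)

From Stdlib Require Import ZArith QArith.
Require Import Defs.
From HB Require Import structures.
From mathcomp Require Import all_boot all_algebra.
From mathcomp Require Import boolp functions reals finmap.
From mathcomp Require Import ring ssrZ.
Import GRing.Theory Num.Theory.
Set Implicit Arguments.
Unset Strict Implicit.
Unset Printing Implicit Defensive.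
Local Close Scope Q_scope.
Local Open Scope ring_scope.

(** * Closure properties of two-sided ideals *)

Section Ideal.
Variables (T : ringType) (S : T -> Prop).
Local Notation I := (in_ideal S).

Lemma in_ideal0 : I 0.
Proof. by exists [::]; split=> //; rewrite big_nil. Qed.

Lemma in_idealD x y : I x -> I y -> I (x + y).
Proof.
move=> [t [St ->]] [u [Su ->]]; exists (t ++ u); rewrite big_cat /=; split=> // p.
by rewrite mem_cat => /orP[/St|/Su].
Qed.

Lemma in_ideal_mul a x b : I x -> I (a * x * b).
Proof.
move=> [t [St ->]]; exists [seq (a * p.1.1, p.1.2, p.2 * b) | p <- t]; split.
  by move=> _ /mapP[p tp ->]; apply: (St p).
by rewrite big_map mulr_sumr mulr_suml; apply: eq_bigr => p _; rewrite /= !mulrA.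
Qed.

Lemma in_idealMl a x : I x -> I (a * x).
Proof. by move=> /(in_ideal_mul a 1); rewrite mulr1. Qed.

Lemma in_idealMr x b : I x -> I (x * b).
Proof. by move=> /(in_ideal_mul 1 b); rewrite mul1r. Qed.

Lemma in_idealN x : I x -> I (- x).
Proof. by rewrite -mulN1r; apply: in_idealMl. Qed.

Lemma in_idealB x y : I x -> I y -> I (x - y).
Proof. by move=> Ix /in_idealN; apply: in_idealD. Qed.

Lemma in_ideal_gen x : S x -> I x.
Proof.
move=> Sx; exists [:: (1, x, 1)]; rewrite big_seq1 mul1r mulr1; split=> // p.
by rewrite inE => /eqP->.
Qed.

Lemma in_ideal_comm x y : I x -> I (comm x y).
Proof. by move=> Ix; apply: in_idealB; [apply: in_idealMr|apply: in_idealMl]. Qed.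

Lemma in_ideal_congr_trans y x z : I (x - y) -> I (y - z) -> I (x - z).
Proof. by move=> xy /(in_idealD xy); rewrite addrA subrK. Qed.

End Ideal.

Lemma in_idealZ (K : ringType) (T : lalgType K) (S : T -> Prop) c x :
  in_ideal S x -> in_ideal S (c *: x).
Proof. by rewrite -mulr_algl; apply: in_idealMl. Qed.

Lemma in_ideal_rmorphism (T U : ringType) (f : {rmorphism T -> U}) S S' x :
  (forall y, S y -> in_ideal S' (f y)) -> in_ideal S x -> in_ideal S' (f x).
Proof.
move=> fS [t [St ->]]; rewrite rmorph_sum big_seq; elim/big_ind: _.
- exact: in_ideal0.
- exact: in_idealD.
- by move=> p /St/fS fp; rewrite !rmorphM; apply: in_ideal_mul.
Qed.

(** * The free algebra acting on a module *)

Section FreeAlgebra.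
Variables (R : realType) (n : nat).
Local Notation C := (CC R).
Local Notation F := (FA R n).

Lemma monomM (v w : {fmonom 'I_n}) : (<< v >> : F) * << w >> = << mmul v w >>.
Proof. by rewrite [LHS](@fgmulUU _ C) mulr1. Qed.

Lemma monomE (w : {fmonom 'I_n}) : (<< w >> : F) = \prod_(i <- w) gen R i.
Proof.
case: w => s; elim: s => [|i s IHs].
  by rewrite big_nil; congr << _ >>; rewrite -fmoneE.
rewrite big_cons -IHs monomM; congr << _ >>.
by apply/eqP; rewrite fmP fmM fmU.
Qed.

Lemma monomZ c (w : {fmonom 'I_n}) : c *: (<< w >> : F) = << c *g w >>.
Proof. by rewrite -mul_malgC [LHS](@fgmulUU _ C) mulr1 mul1m. Qed.

Lemma malg_sumE (x : F) : x = \sum_(w <- msupp x) x@_w *: << w >>.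
Proof. by rewrite {1}[x]monalgE; apply: eq_bigr => w _; rewrite monomZ. Qed.

Lemma malgC_comm (c : C) (x : F) : x * c%:MP = c%:MP * x.
Proof.
rewrite !malgM_def fgmulgU fgmulUg; apply: eq_bigr => w _.
by rewrite mulrC mulm1 mul1m.
Qed.

Lemma FA_scalerAr (c : C) (x y : F) : c *: (x * y) = x * (c *: y).
Proof. by rewrite -!mul_malgC !mulrA malgC_comm. Qed.

Section Action.
Variables (V : lmodType C) (op : 'I_n -> {linear V -> V}).

Definition word_act (w : seq 'I_n) (v : V) : V := foldr (fun i => op i) v w.

Definition fa_act (x : F) (v : V) : V :=
  \sum_(w <- msupp x) x@_w *: word_act w v.

Lemma word_act_is_linear w : linear (word_act w).
Proof.
elim: w => // i w IHw c u v.
by rewrite -[LHS]/(op i (word_act w (c *: u + v))) IHw linearP.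
Qed.

HB.instance Definition _ w :=
  GRing.isLinear.Build C V V _ (word_act w) (word_act_is_linear w).

Lemma fa_act_is_linear x : linear (fa_act x).
Proof.
move=> c u v; rewrite /fa_act scaler_sumr -big_split /=; apply: eq_bigr => w _.
by rewrite linearP scalerDr !scalerA mulrC.
Qed.

HB.instance Definition _ x :=
  GRing.isLinear.Build C V V _ (fa_act x) (fa_act_is_linear x).

Lemma fa_actEw (d : finSet {fmonom 'I_n}) x v :
  fsubset (msupp x) d ->
  fa_act x v = \sum_(w <- d) x@_w *: word_act w v.
Proof.
move=> le; rewrite /fa_act (big_fset_incl _ le) //= => w _.
by move/mcoeff_outdom ->; rewrite scale0r.
Qed.

Lemma fa_actD x y v : fa_act (x + y) v = fa_act x v + fa_act y v.
Proof.
rewrite (fa_actEw _ (msuppD_le x y)).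
rewrite (fa_actEw _ (fsubsetUl (msupp x) (msupp y))).
rewrite (fa_actEw _ (fsubsetUr (msupp x) (msupp y))) -big_split /=.
by apply: eq_bigr => w _; rewrite mcoeffD scalerDl.
Qed.

Lemma fa_actZ c x v : fa_act (c *: x) v = c *: fa_act x v.
Proof.
rewrite (fa_actEw _ (msuppZ_le c x)) /fa_act scaler_sumr.
by apply: eq_bigr => w _; rewrite mcoeffZ scalerA.
Qed.

Lemma fa_act0 v : fa_act 0 v = 0.
Proof. by rewrite /fa_act msupp0 big_seq_fset0. Qed.

Lemma fa_actN x v : fa_act (- x) v = - fa_act x v.
Proof. by rewrite -(scaleN1r x) fa_actZ scaleN1r. Qed.

Lemma fa_act_sum (J : Type) (r : seq J) (G : J -> F) v :
  fa_act (\sum_(i <- r) G i) v = \sum_(i <- r) fa_act (G i) v.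
Proof.
by apply: (big_morph (fa_act^~ v)) => [x y|]; rewrite (fa_actD, fa_act0).
Qed.

Lemma fa_act_monom w v : fa_act << w >> v = word_act w v.
Proof. by rewrite (fa_actEw _ msuppU_le) big_seq_fset1 mcoeffUU scale1r. Qed.

Lemma fa_act1 v : fa_act 1 v = v.
Proof. by have := fa_act_monom mone v; rewrite fm1. Qed.

Lemma fa_act_gen i v : fa_act (gen R i) v = op i v.
Proof. by rewrite fa_act_monom fmU. Qed.

Lemma fa_act_monomM u y v :
  fa_act (<< u >> * y) v = fa_act << u >> (fa_act y v).
Proof.
rewrite {1}[y]malg_sumE mulr_sumr fa_act_sum [fa_act y v]/fa_act.
rewrite linear_sum.
apply: eq_bigr => w _; rewrite -FA_scalerAr (fa_actZ y@_w) linearZ.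
rewrite monomM (fa_act_monom (mmul u w)) fmM /word_act foldr_cat.
by rewrite -[RHS]/(y@_w *: fa_act << u >> (word_act w v)) (fa_act_monom u).
Qed.

Lemma fa_actM (x y : F) v : fa_act (x * y) v = fa_act x (fa_act y v).
Proof.
rewrite {1}[x]malg_sumE mulr_suml fa_act_sum [RHS]/fa_act.
apply: eq_bigr => u _; rewrite -scalerAl (fa_actZ x@_u).
by rewrite fa_act_monomM (fa_act_monom u).
Qed.

Lemma fa_act_ideal (S : F -> Prop) x v :
  (forall y u, S y -> fa_act y u = 0) -> in_ideal S x -> fa_act x v = 0.
Proof.
move=> actS [t [St ->]]; rewrite fa_act_sum big_seq big1 // => p /St/actS Sp.
by rewrite !fa_actM Sp linear0.
Qed.

End Action.
End FreeAlgebra.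

(** * Substitution as an algebra morphism *)

Section Substitution.
Variables (R : realType) (n m : nat) (v : 'I_n -> FA R m).

Definition lmul (x y : FA R m) : FA R m := x * y.

Lemma lmul_is_linear x : linear (lmul x).
Proof. by move=> c y z; rewrite /lmul mulrDr FA_scalerAr. Qed.

HB.instance Definition _ x :=
  GRing.isLinear.Build (CC R) (FA R m) (FA R m) _ (lmul x) (lmul_is_linear x).

Let op i : {linear FA R m -> FA R m} := lmul (v i).

Lemma word_act_mul w y : word_act op w y = (\prod_(i <- w) v i) * y.
Proof.
elim: w => [|i w IHw]; first by rewrite big_nil mul1r.
rewrite -[LHS]/(lmul (v i) (word_act op w y)) IHw big_cons.
exact: (mulrA (v i)).
Qed.

(** Substitution is the action in which generator i multiplies by [v i] on the left.
    Multiplicativity of [fa_subst] is thereby inherited from [fa_actM], evaluated at 1. *)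
Lemma fa_subst_act x y : fa_act op x y = fa_subst v x * y.
Proof.
rewrite /fa_act /fa_subst mulr_suml; apply: eq_bigr => w _.
by rewrite word_act_mul scalerAl.
Qed.

Lemma fa_substE x : fa_subst v x = fa_act op x 1.
Proof. by rewrite fa_subst_act mulr1. Qed.

Lemma fa_subst_is_zmod_morphism : zmod_morphism (fa_subst v).
Proof. by move=> x y; rewrite !fa_substE fa_actD fa_actN. Qed.

HB.instance Definition _ :=
  GRing.isZmodMorphism.Build _ _ (fa_subst v) fa_subst_is_zmod_morphism.

Lemma fa_subst_is_monoid_morphism : monoid_morphism (fa_subst v).
Proof.
split=> [|x y]; first by rewrite fa_substE fa_act1.
by rewrite fa_substE fa_actM fa_subst_act -fa_substE.
Qed.

HB.instance Definition _ :=
  GRing.isMonoidMorphism.Build _ _ (fa_subst v) fa_subst_is_monoid_morphism.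

Lemma fa_substZ c x : fa_subst v (c *: x) = c *: fa_subst v x.
Proof. by rewrite !fa_substE fa_actZ. Qed.

Lemma fa_subst_gen i : fa_subst v (gen R i) = v i.
Proof. by rewrite fa_substE fa_act_gen [LHS]mulr1. Qed.

End Substitution.

(** * Rewriting noncommutative polynomials modulo an ideal *)

Section RationalScalars.
Variable K : numFieldType.

Definition ZK (z : Z) : K := (int_of_Z z)%:~R.

(** Coefficients are kept in the concrete type [Q], which computes, and are only interpreted in
    [K]. *)
Definition QK (q : Q) : K := ZK (Qnum q) / ZK (Z.pos (Qden q)).

Lemma ZKD x y : ZK (Z.add x y) = ZK x + ZK y.
Proof. by rewrite /ZK (raddfD int_of_Z x y) intrD. Qed.

Lemma ZKM x y : ZK (Z.mul x y) = ZK x * ZK y.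
Proof. by rewrite /ZK (rmorphM int_of_Z x y) intrM. Qed.

Lemma ZK_pos_neq0 p : ZK (Z.pos p) != 0.
Proof.
rewrite /ZK intr_eq0 /=; have := Pos2Nat.is_pos p.
by case: Pos.to_nat => // /PeanoNat.Nat.lt_irrefl.
Qed.

Lemma QK_eq p q : Qeq p q -> QK p = QK q.
Proof.
rewrite /Qeq /QK => pq; apply/eqP.
by rewrite eqr_div ?ZK_pos_neq0 // -!ZKM pq.
Qed.

Lemma QKD p q : QK (Qred (Qplus p q)) = QK p + QK q.
Proof.
rewrite (QK_eq (Qred_correct _)) /QK /Qplus /= ZKD !ZKM Pos2Z.inj_mul ZKM.
have := ZK_pos_neq0 (Qden p); have := ZK_pos_neq0 (Qden q).
by move=> *; field; apply/andP.
Qed.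

Lemma QKM p q : QK (Qred (Qmult p q)) = QK p * QK q.
Proof.
rewrite (QK_eq (Qred_correct _)) /QK /Qmult /= ZKM Pos2Z.inj_mul ZKM.
have := ZK_pos_neq0 (Qden p); have := ZK_pos_neq0 (Qden q).
by move=> *; field; apply/andP.
Qed.

Lemma ZK_nat n : ZK (Z.of_nat n) = n%:R.
Proof. by rewrite /ZK (Z_of_intK (Posz n)) -pmulrn. Qed.

End RationalScalars.

Definition Q1 := Qmake (Zpos xH) xH.
Definition Qm1 := Qmake (Zneg xH) xH.

Section Rewriting.
Variables (K : numFieldType) (T : lalgType K).
(* A hypothesis rather than an [algType] structure, because [{malg _[_]}] has the
   latter only over commutative monoids. *)
Hypothesis scaleAr : forall c (x y : T), c *: (x * y) = x * (c *: y).
Variables (env : nat -> T) (S : T -> Prop).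
Local Notation J := (in_ideal S).

Definition ncpoly := seq (Q * seq nat).

Definition wordv (w : seq nat) : T := \prod_(i <- w) env i.
Definition polyv (p : ncpoly) : T := \sum_(t <- p) QK K t.1 *: wordv t.2.

Fixpoint word_eqb (u w : seq nat) : bool :=
  match u, w with
  | [::], [::] => true
  | i :: u', j :: w' => if Nat.eqb i j then word_eqb u' w' else false
  | _, _ => false
  end.

(** Cancelling terms are removed on the spot, so that a successful reduction to zero ends in the
    empty list. *)
Fixpoint add_term (c : Q) (w : seq nat) (p : ncpoly) : ncpoly :=
  if p is (d, u) :: p' then
    if word_eqb w u then
      let e := Qred (Qplus c d) in if Z.eqb (Qnum e) 0 then p' else (e, w) :: p'
    else (d, u) :: add_term c w p'
  else [:: (c, w)].

Definition add_terms (p q : ncpoly) : ncpoly :=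
  foldr (fun t => add_term t.1 t.2) q p.

Definition mul_terms (c : Q) (u : seq nat) (p : ncpoly) (w : seq nat) : ncpoly :=
  [seq (Qred (Qmult c t.1), u ++ t.2 ++ w) | t <- p].

Definition ncmul (p q : ncpoly) : ncpoly :=
  flatten [seq mul_terms t.1 t.2 q [::] | t <- p].

Inductive ncexpr :=
  | NVar of nat | NNat of nat | NAdd of ncexpr & ncexpr | NOpp of ncexpr
  | NMul of ncexpr & ncexpr
  (* [NDiv n x] is x / (n + 1) *)
  | NDiv of nat & ncexpr.

Fixpoint exprv (e : ncexpr) : T :=
  match e with
  | NVar i => env i
  | NNat n => n%:R
  | NAdd a b => exprv a + exprv b
  | NOpp a => - exprv a
  | NMul a b => exprv a * exprv b
  | NDiv n a => n.+1%:R^-1 *: exprv a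
  end.

(** A rule (i, j, p) replaces the two-letter factor ij by p; it is sound modulo an ideal that
    contains the difference of their values. *)
Definition ncrules := seq (nat * nat * ncpoly).

Fixpoint lookup (rs : ncrules) (i j : nat) : option ncpoly :=
  if rs is (a, b, p) :: rs' then
    if Nat.eqb a i && Nat.eqb b j then Some p else lookup rs' i j
  else None.

Fixpoint reduce1 (rs : ncrules) (w : seq nat) : option ncpoly :=
  if w is i :: w' then
    if w' is j :: v then
      if lookup rs i j is Some p then Some (mul_terms Q1 [::] p v) else
      if reduce1 rs w' is Some p then Some (mul_terms Q1 [:: i] p [::]) else None
    else None
  else None.

(* Running out of fuel is harmless: the unreduced terms are kept. *)
Fixpoint ncreduce (fuel : nat) (rs : ncrules) (todo acc : ncpoly) : ncpoly :=
  if fuel is n.+1 then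
    if todo is (c, w) :: todo' then
      if reduce1 rs w is Some p then
        ncreduce n rs (add_terms (mul_terms c [::] p [::]) todo') acc
      else ncreduce n rs todo' (add_term c w acc)
    else acc
  else todo ++ acc.

Arguments ncreduce : simpl never.

(** Among the constructors only a product can create a new reducible factor, so reduction runs only
    there. *)
Fixpoint ncnorm (rs : ncrules) (e : ncexpr) : ncpoly :=
  match e with
  | NVar i => [:: (Q1, [:: i])]
  | NNat n => if n is 0%N then [::] else [:: (Qmake (Z.of_nat n) xH, [::])]
  | NAdd a b => add_terms (ncnorm rs a) (ncnorm rs b)
  | NOpp a => mul_terms Qm1 [::] (ncnorm rs a) [::]
  | NMul a b => ncreduce (Nat.pow 2 12) rs (ncmul (ncnorm rs a) (ncnorm rs b)) [::]
  | NDiv n a =>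
      mul_terms (Qmake (Zpos xH) (Pos.of_succ_nat n)) [::] (ncnorm rs a) [::]
  end.

Definition rules_hold (rs : ncrules) :=
  foldr (fun r P => J (env r.1.1 * env r.1.2 - polyv r.2) /\ P) True rs.

Lemma polyv_cons t p : polyv (t :: p) = QK K t.1 *: wordv t.2 + polyv p.
Proof. by rewrite /polyv big_cons. Qed.

Lemma polyv_nil : polyv [::] = 0.
Proof. by rewrite /polyv big_nil. Qed.

Lemma polyv_cat p q : polyv (p ++ q) = polyv p + polyv q.
Proof. by rewrite /polyv big_cat. Qed.

Lemma word_eqbP u w : word_eqb u w -> u = w.
Proof.
by elim: u w => [|i u IHu] [|j w] //=; case: PeanoNat.Nat.eqb_spec => // -> /IHu->.
Qed.

Lemma polyv_add_term c w p : polyv (add_term c w p) = QK K c *: wordv w + polyv p.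
Proof.
elim: p => [|[d u] p IHp] /=; first by rewrite polyv_cons.
rewrite polyv_cons; case E: word_eqb; last by rewrite polyv_cons IHp addrCA.
rewrite (word_eqbP E); case: Z.eqb_spec => [e0|_].
  by rewrite addrA -scalerDl -QKD /QK e0 /ZK rmorph0 mul0r scale0r add0r.
by rewrite polyv_cons QKD scalerDl addrA.
Qed.

Lemma polyv_add_terms p q : polyv (add_terms p q) = polyv p + polyv q.
Proof.
elim: p => [|t p IHp] /=; first by rewrite polyv_nil add0r.
by rewrite polyv_add_term IHp polyv_cons addrA.
Qed.

Lemma wordv_cat u w : wordv (u ++ w) = wordv u * wordv w.
Proof. by rewrite /wordv big_cat. Qed.

Lemma polyv_mul_terms c u p w :
  polyv (mul_terms c u p w) = QK K c *: (wordv u * polyv p * wordv w).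
Proof.
rewrite /polyv big_map mulr_sumr mulr_suml scaler_sumr; apply: eq_bigr => t _.
by rewrite /= QKM !wordv_cat -scaleAr -scalerAl scalerA mulrA.
Qed.

Lemma polyv_mul p q : polyv (ncmul p q) = polyv p * polyv q.
Proof.
elim: p => [|t p IHp]; first by rewrite polyv_nil mul0r.
rewrite /ncmul /= polyv_cat IHp polyv_mul_terms polyv_cons mulrDl.
by rewrite /wordv big_nil mulr1 scalerAl.
Qed.

Lemma wordv_nil : wordv [::] = 1.
Proof. by rewrite /wordv big_nil. Qed.

Lemma QK1 : QK K Q1 = 1.
Proof. by rewrite /QK divff // ZK_pos_neq0. Qed.

Lemma QKN1 : QK K Qm1 = -1.
Proof. by rewrite /QK /ZK /= divr1. Qed.

Lemma QKinv n : QK K (Qmake (Zpos xH) (Pos.of_succ_nat n)) = n.+1%:R^-1.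
Proof.
by rewrite -[LHS]/(ZK K (Z.of_nat 1) / ZK K (Z.of_nat n.+1)) !ZK_nat mul1r.
Qed.

Lemma lookup_sound rs i j p :
  rules_hold rs -> lookup rs i j = Some p -> J (env i * env j - polyv p).
Proof.
elim: rs => [//|[[a b] q] rs IHrs] /= [hr /IHrs hrs].
case: (PeanoNat.Nat.eqb_spec a i) => [e1|_] //=.
by case: (PeanoNat.Nat.eqb_spec b j) => [e2|_] //= -[<-]; rewrite -e1 -e2.
Qed.

Lemma reduce1_sound rs w p :
  rules_hold rs -> reduce1 rs w = Some p -> J (wordv w - polyv p).
Proof.
move=> hrs; elim: w p => [//|i [//|j v] IHw] p.
have -> : reduce1 rs [:: i, j & v] =
    if lookup rs i j is Some p then Some (mul_terms Q1 [::] p v) else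
    if reduce1 rs (j :: v) is Some p then Some (mul_terms Q1 [:: i] p [::])
    else None by [].
case E: lookup => [q|].
  move=> [<-]; rewrite polyv_mul_terms QK1 scale1r wordv_nil mul1r.
  rewrite /wordv 2!big_cons mulrA -mulrBl.
  exact: in_idealMr (lookup_sound hrs E).
case E': reduce1 => [q|//] [<-].
rewrite polyv_mul_terms QK1 scale1r wordv_nil mulr1.
rewrite -cat1s wordv_cat -mulrBr; apply: in_idealMl; exact: IHw.
Qed.

Lemma ncreduce_sound fuel rs todo acc : rules_hold rs ->
  J (polyv todo + polyv acc - polyv (ncreduce fuel rs todo acc)).
Proof.
move=> hrs; elim: fuel todo acc => [|n IHn] todo acc; rewrite /ncreduce -/ncreduce.
  by rewrite polyv_cat subrr; apply: in_ideal0.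
case: todo => [|[c w] todo]; first by rewrite polyv_nil add0r subrr; apply: in_ideal0.
case E: reduce1 => [p|]; last first.
  apply: in_ideal_congr_trans (IHn _ _); rewrite polyv_cons polyv_add_term.
  by rewrite addrCA addrA subrr; apply: in_ideal0.
apply: in_ideal_congr_trans (IHn _ _); rewrite polyv_cons opprD addrACA subrr addr0.
rewrite polyv_add_terms polyv_mul_terms wordv_nil mul1r mulr1 opprD addrACA subrr addr0 -scalerBr.
exact: in_idealZ (reduce1_sound hrs E).
Qed.

Lemma ncnorm_sound rs e : rules_hold rs -> J (exprv e - polyv (ncnorm rs e)).
Proof.
move=> hrs; have J0 x : J (x - x) by rewrite subrr; apply: in_ideal0.
elim: e => [i|n|a IHa b IHb|a IHa|a IHa b IHb|n a IHa] /=.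
- by rewrite polyv_cons polyv_nil addr0 QK1 scale1r /wordv big_seq1.
- case: n => [|n]; first by rewrite polyv_nil.
  rewrite polyv_cons polyv_nil addr0 wordv_nil /QK ZK_nat.
  by rewrite [ZK _ _](_ : _ = 1) // divr1 scaler_nat.
- by rewrite polyv_add_terms opprD addrACA; apply: in_idealD.
- rewrite polyv_mul_terms wordv_nil mul1r mulr1 QKN1 scaleN1r -opprD.
  exact: in_idealN.
- apply: in_ideal_congr_trans (ncreduce_sound _ _ _ hrs).
  rewrite polyv_nil addr0 polyv_mul.
  (* With a', b' the normal forms, ab - a'b' = (a - a')b + a'(b - b'). *)
  rewrite -[exprv a * exprv b](subrK (polyv (ncnorm rs a) * exprv b)).
  rewrite -mulrBl -addrA -mulrBr.
  by apply: in_idealD; [apply: in_idealMr|apply: in_idealMl].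
- rewrite polyv_mul_terms wordv_nil mul1r mulr1 QKinv -scalerBr.
  exact: in_idealZ.
Qed.

End Rewriting.

Section RewritingExpr.
Variables (K : numFieldType) (T : lalgType K).
Hypothesis scaleAr : forall c (x y : T), c *: (x * y) = x * (c *: y).
Variable env : nat -> T.

Definition compile_rules (ers : seq (nat * nat * ncexpr)) : ncrules :=
  [seq (r.1, ncnorm [::] r.2) | r <- ers].

Definition reduces_to0 ers e := ncnorm (compile_rules ers) e = [::].

Lemma exprv_ncnorm e : exprv env e = polyv env (ncnorm [::] e).
Proof.
apply/eqP; rewrite -subr_eq0; apply/eqP.
(* The ideal generated by the empty set is zero, so the congruence is an equality. *)
have [t [t0 ->]] := @ncnorm_sound _ _ scaleAr env (fun _ => False) [::] e I.
by rewrite big_seq big1 // => p /t0.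
Qed.

Lemma nc_ideal (S : T -> Prop) ers e :
  foldr (fun r P => in_ideal S (env r.1.1 * env r.1.2 - exprv env r.2) /\ P)
    True ers ->
  reduces_to0 ers e -> in_ideal S (exprv env e).
Proof.
move=> hers red; have hrs : rules_hold env S (compile_rules ers).
  elim: ers hers {red} => //= r ers IHers [hr /IHers hers]; split=> //=.
  by rewrite -exprv_ncnorm.
by have := ncnorm_sound scaleAr e hrs; rewrite red polyv_nil subr0.
Qed.

Lemma nc_eq a b : reduces_to0 [::] (NAdd a (NOpp b)) -> exprv env a = exprv env b.
Proof.
move=> red; apply/eqP; rewrite -subr_eq0; apply/eqP.
by rewrite [LHS](exprv_ncnorm (NAdd a (NOpp b))) [ncnorm _ _]red polyv_nil.
Qed.

End RewritingExpr.

(** * Reflexive tactics for identities and ideal membership *)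

Ltac nc_index x xs :=
  lazymatch xs with
  | x :: _ => constr:(O)
  | _ :: ?ys => let i := nc_index x ys in constr:(S i)
  end.

Ltac nc_reify xs t :=
  lazymatch t with
  | ?a + ?b => let a' := nc_reify xs a in let b' := nc_reify xs b in
               constr:(NAdd a' b')
  | - ?a => let a' := nc_reify xs a in constr:(NOpp a')
  | ?a * ?b => let a' := nc_reify xs a in let b' := nc_reify xs b in
               constr:(NMul a' b')
  | ?a ^+ 2 => let a' := nc_reify xs a in constr:(NMul a' a')
  | (?n%:R)^-1 *: ?a => let a' := nc_reify xs a in
               let n' := eval compute in n.-1 in constr:(NDiv n' a')
  | ?n%:R => constr:(NNat n)
  | 1 => constr:(NNat 1)
  | 0 => constr:(NNat 0)
  | _ => let i := nc_index t xs in constr:(NVar i)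
  end.

Ltac nc_ring scaleAr xs :=
  lazymatch goal with
  | |- ?a = ?b =>
    let a' := nc_reify xs a in let b' := nc_reify xs b in
    refine (@nc_eq _ _ scaleAr (fun i => nth 0 xs i) a' b' _);
    vm_compute; reflexivity
  end.

Ltac nc_in_ideal scaleAr xs rs H :=
  lazymatch goal with
  | |- in_ideal ?S ?a =>
    let a' := nc_reify xs a in
    refine (@nc_ideal _ _ scaleAr (fun i => nth 0 xs i) S rs a' H _);
    vm_compute; reflexivity
  end.

(** * Expressions in the Racah generators *)

Section RacahExpressions.
Variables (K : numFieldType) (T : lalgType K) (a b c d : T).

(** Arbitrary arguments let the same formulas serve for the generators of the Racah algebra, for
    their images under [sharp], and for the scalars of a character. *)
Definition alpha_expr := a * d - d * a + a * c - b * a.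
Definition beta_expr := b * d - d * b + b * a - c * b.
Definition gamma_expr := c * d - d * c + c * b - a * c.
Definition delta_expr := a + b + c.

Definition omegaA_expr :=
  d ^+ 2 + 2%:R^-1 *: (b * a * c + c * a * b) + a ^+ 2
  + b * gamma_expr - c * beta_expr - a * delta_expr.
Definition omegaB_expr :=
  d ^+ 2 + 2%:R^-1 *: (c * b * a + a * b * c) + b ^+ 2
  + c * alpha_expr - a * gamma_expr - b * delta_expr.
Definition omegaC_expr :=
  d ^+ 2 + 2%:R^-1 *: (a * c * b + b * c * a) + c ^+ 2
  + a * beta_expr - b * alpha_expr - c * delta_expr.

Definition w_expr (om : T) : T :=
  256%:R * om
  + 3%:R * ((4%:R * delta_expr - 3%:R) * (4%:R * delta_expr + 1)).
End RacahExpressions.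

Lemma morph_commutator (T U : ringType) (f : {rmorphism T -> U}) x y :
  f (comm x y) = comm (f x) (f y).
Proof. by rewrite /comm rmorphB !rmorphM. Qed.

Section RacahMorphism.
Variables (K : numFieldType) (T U : lalgType K) (f : {rmorphism T -> U}).
Hypothesis fZ : forall c x, f (c *: x) = c *: f x.
Variables a b c d : T.

Lemma alpha_exprE :
  f (alpha_expr a b c d) = alpha_expr (f a) (f b) (f c) (f d).
Proof. by rewrite /alpha_expr !(rmorphB, rmorphD, rmorphM). Qed.

Lemma beta_exprE :
  f (beta_expr a b c d) = beta_expr (f a) (f b) (f c) (f d).
Proof. by rewrite /beta_expr !(rmorphB, rmorphD, rmorphM). Qed.

Lemma gamma_exprE :
  f (gamma_expr a b c d) = gamma_expr (f a) (f b) (f c) (f d).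
Proof. by rewrite /gamma_expr !(rmorphB, rmorphD, rmorphM). Qed.

Lemma delta_exprE : f (delta_expr a b c) = delta_expr (f a) (f b) (f c).
Proof. by rewrite /delta_expr !rmorphD. Qed.

Let exprE := (alpha_exprE, beta_exprE, gamma_exprE, delta_exprE).

Lemma omegaA_exprE :
  f (omegaA_expr a b c d) = omegaA_expr (f a) (f b) (f c) (f d).
Proof.
by rewrite /omegaA_expr !(rmorphB, rmorphD, rmorphM, rmorphXn, fZ, exprE).
Qed.

Lemma omegaB_exprE :
  f (omegaB_expr a b c d) = omegaB_expr (f a) (f b) (f c) (f d).
Proof.
by rewrite /omegaB_expr !(rmorphB, rmorphD, rmorphM, rmorphXn, fZ, exprE).
Qed.

Lemma omegaC_exprE :
  f (omegaC_expr a b c d) = omegaC_expr (f a) (f b) (f c) (f d).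
Proof.
by rewrite /omegaC_expr !(rmorphB, rmorphD, rmorphM, rmorphXn, fZ, exprE).
Qed.

Lemma w_exprE om : f (w_expr a b c om) = w_expr (f a) (f b) (f c) (f om).
Proof.
by rewrite /w_expr !(rmorphB, rmorphD, rmorphM, rmorph1, rmorph_nat, exprE).
Qed.

Lemma commB_exprE : f (a * b - b * a - 2%:R * d) = f a * f b - f b * f a - 2%:R * f d.
Proof. by rewrite !(rmorphB, rmorphM, rmorph_nat). Qed.

End RacahMorphism.

(** * A spanning set modulo the relations *)

Section RacahRules.
Variables (K : numFieldType) (T : lalgType K).
Hypothesis scaleAr : forall c (x y : T), c *: (x * y) = x * (c *: y).
Variables (S : T -> Prop) (a b d e : T).
Local Notation I := (in_ideal S).
Local Notation c := (e - a - b).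
Local Notation letters := [:: a; b; d; e].
Hypothesis hAB : I (a * b - b * a - 2%:R * d).
Hypothesis hBC : I (b * c - c * b - 2%:R * d).
Hypothesis hCA : I (c * a - a * c - 2%:R * d).
Hypothesis halpha : I (alpha_expr a b c d).
Hypothesis hbeta : I (beta_expr a b c d).

Ltac ncr := nc_ring scaleAr [:: a; b; d; e].

Lemma mod_ae : I (a * e - e * a).
Proof. by have := in_idealB hAB hCA; congr I; ncr. Qed.

Lemma mod_be : I (b * e - e * b).
Proof. by have := in_idealB hBC hAB; congr I; ncr. Qed.

(** Modulo the ideal 2 Delta is [A, B], and delta commutes with both A and B. *)
Lemma mod_de : I (d * e - e * d).
Proof.
have h1 := in_idealB (in_idealMr b mod_ae) (in_idealMl b mod_ae).
have h2 := in_idealB (in_idealMl a mod_be) (in_idealMr a mod_be).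
have h3 := in_idealB (in_idealMl e hAB) (in_idealMr e hAB).
have := in_idealZ 2%:R^-1 (in_idealD (in_idealD h1 h2) h3).
by congr I; ncr.
Qed.

(** This is alpha = 0 with C replaced by delta - A - B, solved for A Delta; [mod_db] treats beta in
    the same way. *)
Lemma mod_ad : I (a * d - (d * a + a * a + 2%:R * (b * a) + 2%:R * d - e * a)).
Proof.
have := in_idealD (in_idealB halpha mod_ae) hAB.
by congr I; rewrite /alpha_expr; ncr.
Qed.

Lemma mod_db :
  I (d * b - (b * d - e * b + b * b + 2%:R * (b * a) + 2%:R * d)).
Proof.
have := in_idealB hAB hbeta.
by congr I; rewrite /beta_expr; ncr.
Qed.

Lemma mod_ab : I (a * b - (b * a + 2%:R * d)).
Proof. by have := hAB; rewrite opprD addrA. Qed.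

(* The letters 0, 1, 2, 3 stand for A, B, Delta and delta. *)
Definition racah_rules : seq (nat * nat * ncexpr) :=
  [:: (0%N, 3%N, NMul (NVar 3) (NVar 0));
      (1%N, 3%N, NMul (NVar 3) (NVar 1));
      (2%N, 3%N, NMul (NVar 3) (NVar 2));
      (0%N, 1%N, NAdd (NMul (NVar 1) (NVar 0)) (NMul (NNat 2) (NVar 2)));
      (0%N, 2%N, NAdd (NAdd (NAdd (NAdd
        (NMul (NVar 2) (NVar 0)) (NMul (NVar 0) (NVar 0)))
        (NMul (NNat 2) (NMul (NVar 1) (NVar 0)))) (NMul (NNat 2) (NVar 2)))
        (NOpp (NMul (NVar 3) (NVar 0))));
      (2%N, 1%N, NAdd (NAdd (NAdd (NAdd
        (NMul (NVar 1) (NVar 2)) (NOpp (NMul (NVar 3) (NVar 1))))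
        (NMul (NVar 1) (NVar 1))) (NMul (NNat 2) (NMul (NVar 1) (NVar 0))))
        (NMul (NNat 2) (NVar 2)))].

(** The rules sort words into the order delta, B, Delta, A. Powers of Delta are left alone by them;
    bounding these takes the relation w = 0. *)
Lemma racah_rules_hold :
  foldr (fun r P => I (nth 0 letters r.1.1 * nth 0 letters r.1.2
                       - exprv (nth 0 letters) r.2) /\ P)
    True racah_rules.
Proof.
split; first exact: mod_ae.
split; first exact: mod_be.
split; first exact: mod_de.
split; first exact: mod_ab.
split; first exact: mod_ad.
split; first exact: mod_db.
by [].
Qed.

(* The value of Delta^2 obtained by solving w = 0; it is the same for the three
   Casimir elements, which agree modulo alpha and beta. *)
Definition dd_nf : T :=
  b * a * a - e * b * a - 16%:R^-1 *: (3%:R * e * e) + 32%:R^-1 *: (3%:R * e)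
  + 256%:R^-1 *: 9%:R + 2%:R * b * d - e * d + 2%:R * d + 2%:R * b * a
  + 2%:R * d * a + b * b * a.

Ltac by_racah :=
  rewrite /dd_nf /w_expr /omegaA_expr /omegaB_expr /omegaC_expr /delta_expr
    /alpha_expr /beta_expr /gamma_expr;
  nc_in_ideal scaleAr [:: a; b; d; e] racah_rules racah_rules_hold.

Lemma dd_nf_wA :
  I (d * d - dd_nf - 256%:R^-1 *: w_expr a b c (omegaA_expr a b c d)).
Proof. by_racah. Qed.

Lemma dd_nf_wB :
  I (d * d - dd_nf - 256%:R^-1 *: w_expr a b c (omegaB_expr a b c d)).
Proof. by_racah. Qed.

Lemma dd_nf_wC :
  I (d * d - dd_nf - 256%:R^-1 *: w_expr a b c (omegaC_expr a b c d)).
Proof. by_racah. Qed.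

(** The sum alpha + beta + gamma telescopes to [delta, Delta], which lies in the ideal by
    [mod_de]. *)
Lemma gamma_mod : I (gamma_expr a b c d).
Proof. by_racah. Qed.

(** The boolean is the exponent of Delta, which is at most 1 once Delta^2 can be eliminated. *)
Definition nf_monom (m : nat * nat * bool * nat) : T :=
  let: (i, j, l, k) := m in
  e ^+ i * (b ^+ j * ((if l then d else 1) * a ^+ k)).

Definition nf_sum (t : seq (K * (nat * nat * bool * nat))) : T :=
  \sum_(p <- t) p.1 *: nf_monom p.2.

Definition has_nf (x : T) : Prop := exists t, I (x - nf_sum t).

Lemma has_nf_congr y x : has_nf y -> I (x - y) -> has_nf x.
Proof. by move=> [t It] Ixy; exists t; apply: in_ideal_congr_trans It. Qed.

Lemma has_nf0 : has_nf 0.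
Proof. by exists [::]; rewrite /nf_sum big_nil subrr; apply: in_ideal0. Qed.

Lemma has_nfD x y : has_nf x -> has_nf y -> has_nf (x + y).
Proof.
move=> [t It] [u Iu]; exists (t ++ u).
by rewrite /nf_sum big_cat /= opprD addrACA; apply: in_idealD.
Qed.

Lemma has_nfZ z x : has_nf x -> has_nf (z *: x).
Proof.
move=> [t It]; exists [seq (z * p.1, p.2) | p <- t].
rewrite /nf_sum big_map -(eq_bigr _ (fun p _ => scalerA _ _ _)) -scaler_sumr.
by rewrite -scalerBr; apply: in_idealZ.
Qed.

Lemma has_nfN x : has_nf x -> has_nf (- x).
Proof. by rewrite -scaleN1r; apply: has_nfZ. Qed.

Lemma has_nfB x y : has_nf x -> has_nf y -> has_nf (x - y).
Proof. by move=> ? /has_nfN; apply: has_nfD. Qed.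

Lemma has_nf_natl n x : has_nf x -> has_nf (n%:R * x).
Proof. by rewrite mulr_natl -scaler_nat; apply: has_nfZ. Qed.

Lemma has_nf_monom m : has_nf (nf_monom m).
Proof.
by exists [:: (1, m)]; rewrite /nf_sum big_seq1 scale1r subrr; apply: in_ideal0.
Qed.

Lemma has_nf_mul z x :
  (forall m, has_nf (z * nf_monom m)) -> has_nf x -> has_nf (z * x).
Proof.
move=> hz [t It]; apply: (@has_nf_congr (z * nf_sum t)); last first.
  by rewrite -mulrBr; apply: in_idealMl.
rewrite /nf_sum mulr_sumr; elim/big_ind: _ => [||p _].
- exact: has_nf0.
- exact: has_nfD.
- by rewrite -scaleAr; apply: has_nfZ.
Qed.

Lemma has_nf_e x : has_nf x -> has_nf (e * x).
Proof.
apply: has_nf_mul => -[[[i j] l] k].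
by have := has_nf_monom (i.+1, j, l, k); rewrite /= exprS -mulrA.
Qed.

Lemma mod_e_exp z i : I (z * e - e * z) -> I (z * e ^+ i - e ^+ i * z).
Proof.
move=> Iz; elim: i => [|i IHi]; first by rewrite mulr1 mul1r subrr; apply: in_ideal0.
have := in_idealD (in_idealMr (e ^+ i) Iz) (in_idealMl e IHi).
by rewrite mulrBl mulrBr !mulrA subrKA exprS !mulrA.
Qed.

Lemma has_nf_b x : has_nf x -> has_nf (b * x).
Proof.
apply: has_nf_mul => -[[[i j] l] k].
apply: has_nf_congr (has_nf_monom (i, j.+1, l, k)) _.
have := in_idealMr (b ^+ j * ((if l then d else 1) * a ^+ k)) (mod_e_exp i mod_be).
by congr I; rewrite /= exprS mulrBl !mulrA.
Qed.

Lemma has_nf_ea k : has_nf (a ^+ k).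
Proof. by have := has_nf_monom (0, 0, false, k)%N; rewrite /= !mul1r. Qed.

Lemma has_nf_da k : has_nf (d * a ^+ k).
Proof. by have := has_nf_monom (0, 0, true, k)%N; rewrite /= !mul1r. Qed.

Hypothesis hdd : I (d * d - dd_nf).

(** A and Delta have to be treated together: moving A past B produces Delta, and moving Delta past B
    produces BA. The induction strips powers of delta first, then powers of B. *)
Lemma has_nf_ad m : has_nf (a * nf_monom m) /\ has_nf (d * nf_monom m).
Proof.
case: m => [[[i j] l] k]; rewrite /nf_monom.
elim: i => [|i [IHa IHd]]; last first.
  have pull z y : I (z * e - e * z) -> has_nf (z * y) -> has_nf (z * (e * y)).
    move=> Iz /has_nf_e hy; apply: has_nf_congr hy _.
    by rewrite !mulrA -mulrBl; apply: in_idealMr.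
  rewrite exprS -(mulrA e).
  by split; apply: pull => //; [apply: mod_ae|apply: mod_de].
rewrite mul1r; elim: j => [|j [IHa IHd]]; last first.
  rewrite exprS -(mulrA b); set y := b ^+ j * _ in IHa IHd *.
  split.
    apply: (has_nf_congr (has_nfD (has_nf_b IHa) (has_nf_natl 2 IHd))).
    have := in_idealMr y mod_ab; congr I.
    nc_ring scaleAr [:: a; b; d; e; y].
  have hy : has_nf y.
    have := has_nf_monom (0, j, l, k)%N; rewrite /nf_monom mul1r; exact.
  apply: (has_nf_congr (has_nfD (has_nfD (has_nfD (has_nfB (has_nf_b IHd)
    (has_nf_e (has_nf_b hy))) (has_nf_b (has_nf_b hy)))
    (has_nf_natl 2 (has_nf_b IHa))) (has_nf_natl 2 IHd))).
  have := in_idealMr y mod_db; congr I.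
  nc_ring scaleAr [:: a; b; d; e; y].
rewrite mul1r; case: l; last first.
  by rewrite mul1r -exprS; split; [apply: has_nf_ea|apply: has_nf_da].
have aS : a * a ^+ k = a ^+ k.+1 by rewrite exprS.
split.
  apply: (has_nf_congr (has_nfB (has_nfD (has_nfD (has_nfD (has_nf_da k.+1)
    (has_nf_ea k.+2)) (has_nf_natl 2 (has_nf_b (has_nf_ea k.+1))))
    (has_nf_natl 2 (has_nf_da k))) (has_nf_e (has_nf_ea k.+1)))).
  have := in_idealMr (a ^+ k) mod_ad; congr I.
  rewrite !exprS; set y := a ^+ k.
  nc_ring scaleAr [:: a; b; d; e; y].
have ha0 := has_nf_ea k; have ha1 := has_nf_ea k.+1; have ha2 := has_nf_ea k.+2.
have hd0 := has_nf_da k; have hd1 := has_nf_da k.+1.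
have hs (n p : nat) y : has_nf y -> has_nf (n.+1%:R^-1 *: (p%:R * y)).
  by move=> hy; apply: has_nfZ; apply: has_nf_natl.
(* Here a square of Delta appears, and it is replaced using [hdd]; every word of [dd_nf] followed by
   A^k is again sorted with at most one Delta. *)
apply: (@has_nf_congr (dd_nf * a ^+ k)); last first.
  by have := in_idealMr (a ^+ k) hdd; rewrite mulrBl mulrA.
have -> : dd_nf * a ^+ k =
    b * a ^+ k.+2 - e * (b * a ^+ k.+1) - 16%:R^-1 *: (3%:R * (e * (e * a ^+ k)))
    + 32%:R^-1 *: (3%:R * (e * a ^+ k)) + 256%:R^-1 *: (9%:R * a ^+ k)
    + 2%:R * (b * (d * a ^+ k)) - e * (d * a ^+ k) + 2%:R * (d * a ^+ k)
    + 2%:R * (b * a ^+ k.+1) + 2%:R * (d * a ^+ k.+1) + b * (b * a ^+ k.+1).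
  rewrite /dd_nf !exprS; set y := a ^+ k.
  nc_ring scaleAr [:: a; b; d; e; y].
do ![assumption | apply: has_nfB | apply: has_nfD | apply: hs
  | apply: has_nf_natl | apply: has_nf_b | apply: has_nf_e].
Qed.

Lemma has_nf_a x : has_nf x -> has_nf (a * x).
Proof. by apply: has_nf_mul => m; case: (has_nf_ad m). Qed.

Lemma has_nf_d x : has_nf x -> has_nf (d * x).
Proof. by apply: has_nf_mul => m; case: (has_nf_ad m). Qed.

Lemma has_nf_c x : has_nf x -> has_nf (c * x).
Proof.
move=> hx; rewrite !mulrBl.
apply: has_nfB; last exact: has_nf_b.
by apply: has_nfB; [apply: has_nf_e|apply: has_nf_a].
Qed.

Lemma has_nf1 : has_nf 1.
Proof. exact: (has_nf_ea 0). Qed.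

End RacahRules.

(** * The same consequences with C as an element of its own *)

Section RacahConsequences.
Variables (K : numFieldType) (T : lalgType K).
Hypothesis scaleAr : forall c (x y : T), c *: (x * y) = x * (c *: y).
Variables (S : T -> Prop) (a b c d e : T).
Local Notation I := (in_ideal S).
Hypothesis ce : c = e - a - b.
Hypothesis hAB : I (a * b - b * a - 2%:R * d).
Hypothesis hBC : I (b * c - c * b - 2%:R * d).
Hypothesis hCA : I (c * a - a * c - 2%:R * d).
Hypothesis halpha : I (alpha_expr a b c d).
Hypothesis hbeta : I (beta_expr a b c d).

Lemma gamma_in_ideal : I (gamma_expr a b c d).
Proof.
move: hAB hBC hCA halpha hbeta; rewrite ce => h1 h2 h3 h4 h5.
exact: gamma_mod.
Qed.

Lemma dd_nf_w om : om = omegaA_expr a b c d \/ om = omegaB_expr a b c d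
    \/ om = omegaC_expr a b c d ->
  I (d * d - dd_nf a b d e - 256%:R^-1 *: w_expr a b c om).
Proof.
move: hAB hBC hCA halpha hbeta; rewrite ce => h1 h2 h3 h4 h5.
case=> [->|[->|->]]; [exact: dd_nf_wA|exact: dd_nf_wB|exact: dd_nf_wC].
Qed.

(** For U(sl2): a single verification of the value of Delta^2 yields the relation w = 0 for all
    three Casimir elements. *)
Lemma w_in_ideal : I (d * d - dd_nf a b d e) ->
  forall om, om = omegaA_expr a b c d \/ om = omegaB_expr a b c d
    \/ om = omegaC_expr a b c d -> I (w_expr a b c om).
Proof.
move=> hdd om /dd_nf_w hom.
have := in_idealZ 256%:R (in_idealB hdd hom).
by rewrite opprB addrC subrK scalerA mulfV ?pnatr_eq0 // scale1r.
Qed.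

Lemma racah_nf_closed om x :
  om = omegaA_expr a b c d \/ om = omegaB_expr a b c d
    \/ om = omegaC_expr a b c d ->
  I (w_expr a b c om) -> has_nf S a b d e x ->
  [/\ has_nf S a b d e (a * x), has_nf S a b d e (b * x),
      has_nf S a b d e (c * x) & has_nf S a b d e (d * x)].
Proof.
move=> /dd_nf_w hom hw hx.
have hdd : I (d * d - dd_nf a b d e).
  by have := in_idealD hom (in_idealZ 256%:R^-1 hw); rewrite subrK.
move: hAB hBC hCA halpha hbeta; rewrite ce => h1 h2 h3 h4 h5.
by split; [apply: has_nf_a|apply: has_nf_b|apply: has_nf_c|apply: has_nf_d].
Qed.

End RacahConsequences.

(** * The homomorphism [sharp] kills the relations *)

Lemma add3K (M : zmodType) (a b c : M) : c = a + b + c - a - b.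
Proof. by rewrite -addrA -opprD [a + b + c]addrC addrK. Qed.

Section Sl2Identities.
Variables (K : numFieldType) (T : lalgType K).
Hypothesis scaleAr : forall c (x y : T), c *: (x * y) = x * (c *: y).
Variables (S : T -> Prop) (E F H i_ : T).
Local Notation J := (in_ideal S).
Hypothesis HE : J (H * E - E * H - 2%:R * E).
Hypothesis HF : J (H * F - F * H + 2%:R * F).
Hypothesis EF : J (E * F - F * E - H).
Hypothesis ii : i_ * i_ = - 1.
Hypothesis iC : forall x, x * i_ = i_ * x.

(* The letters 0, 1, 2, 3 stand for E, F, H and the scalar i. *)
Definition sl2_rules : seq (nat * nat * ncexpr) :=
  [:: (1%N, 0%N, NAdd (NMul (NVar 0) (NVar 1)) (NOpp (NVar 2)));
      (2%N, 0%N, NAdd (NMul (NVar 0) (NVar 2)) (NMul (NNat 2) (NVar 0)));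
      (2%N, 1%N, NAdd (NMul (NVar 1) (NVar 2)) (NOpp (NMul (NNat 2) (NVar 1))));
      (0%N, 3%N, NMul (NVar 3) (NVar 0));
      (1%N, 3%N, NMul (NVar 3) (NVar 1));
      (2%N, 3%N, NMul (NVar 3) (NVar 2));
      (3%N, 3%N, NOpp (NNat 1))].

(** The rules sort into the Poincaré-Birkhoff-Witt order E, F, H. The imaginary unit, which is not a
    rational coefficient, is a central letter moved to the front, with square -1. *)
Lemma sl2_rules_hold :
  foldr (fun r P => J (nth 0 [:: E; F; H; i_] r.1.1 * nth 0 [:: E; F; H; i_] r.1.2
                       - exprv (nth 0 [:: E; F; H; i_]) r.2) /\ P)
    True sl2_rules.
Proof.
have J0 x y : x = y -> J (x - y) by move=> ->; rewrite subrr; apply: in_ideal0.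
do !split=> /=; try by apply: J0; rewrite ?ii ?iC.
- by have := in_idealN EF; congr J; nc_ring scaleAr [:: E; F; H].
- by have := HE; congr J; nc_ring scaleAr [:: E; F; H].
- by have := HF; congr J; nc_ring scaleAr [:: E; F; H].
Qed.

Definition sA : T := 16%:R^-1 *: ((E + F - 2%:R) * (E + F + 2%:R)).
Definition sB : T := 16%:R^-1 *: ((H - 2%:R) * (H + 2%:R)).
Definition sC : T := 16%:R^-1 *:
  ((i_ * E - i_ * F - 2%:R) * (i_ * E - i_ * F + 2%:R)).
Definition sD : T := 64%:R^-1 *: ((H + 2%:R) * F ^+ 2 - (H - 2%:R) * E ^+ 2).

Ltac by_sl2 :=
  rewrite /dd_nf /delta_expr /alpha_expr /beta_expr /sA /sB /sC /sD;
  nc_in_ideal scaleAr [:: E; F; H; i_] sl2_rules sl2_rules_hold.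

Lemma sl2_commAB : J (sA * sB - sB * sA - 2%:R * sD). Proof. by_sl2. Qed.
Lemma sl2_commBC : J (sB * sC - sC * sB - 2%:R * sD). Proof. by_sl2. Qed.
Lemma sl2_commCA : J (sC * sA - sA * sC - 2%:R * sD). Proof. by_sl2. Qed.
Lemma sl2_alpha : J (alpha_expr sA sB sC sD). Proof. by_sl2. Qed.
Lemma sl2_beta : J (beta_expr sA sB sC sD). Proof. by_sl2. Qed.
Lemma sl2_dd : J (sD * sD - dd_nf sA sB sD (delta_expr sA sB sC)).
Proof. by_sl2. Qed.

Lemma sl2_gamma : J (gamma_expr sA sB sC sD).
Proof.
exact: (gamma_in_ideal scaleAr (add3K _ _ _) sl2_commAB sl2_commBC sl2_commCA
  sl2_alpha sl2_beta).
Qed.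

Lemma sl2_w om : om = omegaA_expr sA sB sC sD \/ om = omegaB_expr sA sB sC sD
  \/ om = omegaC_expr sA sB sC sD -> J (w_expr sA sB sC om).
Proof.
exact: (w_in_ideal scaleAr (add3K _ _ _) sl2_commAB sl2_commBC sl2_commCA
  sl2_alpha sl2_beta sl2_dd).
Qed.
End Sl2Identities.

Section SharpKernel.
Variable R : realType.
Local Notation C := (CC R).
Local Notation J := (in_ideal (@sl2_rel R)).
Local Notation i_ := (sc ('i : C)).

Lemma sc_comm (c : C) x : x * sc c = sc c * x.
Proof. by rewrite /sc -FA_scalerAr -scalerAl mulr1 mul1r. Qed.

Lemma sc_i_sqr : i_ * i_ = - 1.
Proof. by rewrite /sc -FA_scalerAr -scalerAl mulr1 scalerA -expr2 sqrCi scaleN1r. Qed.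

Local Notation E := (uE R).
Local Notation F := (uF R).
Local Notation H := (uH R).

Lemma sl2_HE : J (H * E - E * H - 2%:R * E).
Proof. by apply: in_ideal_gen; left. Qed.
Lemma sl2_HF : J (H * F - F * H + 2%:R * F).
Proof. by apply: in_ideal_gen; right; left. Qed.
Lemma sl2_EF : J (E * F - F * E - H).
Proof. by apply: in_ideal_gen; right; right. Qed.

Local Notation A' := (sA E F).
Local Notation B' := (sB H).
Local Notation C' := (sC E F i_).
Local Notation D' := (sD E F H).

Lemma sharpA : sharp (rA R) = A'. Proof. exact: fa_subst_gen. Qed.
Lemma sharpB : sharp (rB R) = B'. Proof. exact: fa_subst_gen. Qed.
Lemma sharpC : sharp (rC R) = C'. Proof. exact: fa_subst_gen. Qed.
Lemma sharpD : sharp (rD R) = D'. Proof. exact: fa_subst_gen. Qed.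

Let sharp_rm : {rmorphism FA R 4 -> FA R 3} := fa_subst (@sharp_gen R).

Lemma sharpZ (c : C) x : sharp_rm (c *: x) = c *: sharp_rm x.
Proof. exact: fa_substZ. Qed.

Local Notation sharp_on := (sharpA, sharpB, sharpC, sharpD).

Lemma sharp_alpha : sharp (ralpha R) = alpha_expr A' B' C' D'.
Proof. by rewrite -!sharp_on; exact: (alpha_exprE sharp_rm). Qed.

Lemma sharp_beta : sharp (rbeta R) = beta_expr A' B' C' D'.
Proof. by rewrite -!sharp_on; exact: (beta_exprE sharp_rm). Qed.

Lemma sharp_gamma : sharp (rgamma R) = gamma_expr A' B' C' D'.
Proof. by rewrite -!sharp_on; exact: (gamma_exprE sharp_rm). Qed.

Lemma sharp_delta : sharp (rdelta R) = delta_expr A' B' C'.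
Proof. by rewrite -!sharp_on; exact: (delta_exprE sharp_rm). Qed.

Lemma sharp_w om : sharp (omega_elt om) = w_expr A' B' C' (sharp om).
Proof. by rewrite -!sharp_on; exact: (w_exprE sharp_rm). Qed.

Lemma sharp_omegaA : sharp (OmegaA R) = omegaA_expr A' B' C' D'.
Proof. by rewrite -!sharp_on; exact: (omegaA_exprE sharpZ). Qed.

Lemma sharp_omegaB : sharp (OmegaB R) = omegaB_expr A' B' C' D'.
Proof. by rewrite -!sharp_on; exact: (omegaB_exprE sharpZ). Qed.

Lemma sharp_omegaC : sharp (OmegaC R) = omegaC_expr A' B' C' D'.
Proof. by rewrite -!sharp_on; exact: (omegaC_exprE sharpZ). Qed.

Lemma sharp_commAB :
  sharp (comm (rA R) (rB R) - 2%:R * rD R) = A' * B' - B' * A' - 2%:R * D'.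
Proof. by rewrite -!sharp_on; exact: (commB_exprE sharp_rm). Qed.

Lemma sharp_commBC :
  sharp (comm (rB R) (rC R) - 2%:R * rD R) = B' * C' - C' * B' - 2%:R * D'.
Proof. by rewrite -!sharp_on; exact: (commB_exprE sharp_rm). Qed.

Lemma sharp_commCA :
  sharp (comm (rC R) (rA R) - 2%:R * rD R) = C' * A' - A' * C' - 2%:R * D'.
Proof. by rewrite -!sharp_on; exact: (commB_exprE sharp_rm). Qed.

Lemma sharp_commutator (u v : FA R 4) :
  sharp (comm u v) = comm (sharp u) (sharp v).
Proof. exact: (morph_commutator sharp_rm u v). Qed.

Definition is_casimir (Om : FA R 4) :=
  Om = OmegaA R \/ Om = OmegaB R \/ Om = OmegaC R.

(** The centrality relations are respected because alpha, beta and gamma themselves vanish in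
    U(sl2). *)
Lemma sharp_relations_in_ideal Om y : is_casimir Om ->
  racah_rel y \/ y = ralpha R \/ y = rbeta R \/ y = omega_elt Om ->
  J (sharp y).
Proof.
have scaleAr := @FA_scalerAr R 3.
have Ja : J (sharp (ralpha R)).
  rewrite sharp_alpha.
  exact: (sl2_alpha scaleAr sl2_HE sl2_HF sl2_EF sc_i_sqr (sc_comm _)).
have Jb : J (sharp (rbeta R)).
  rewrite sharp_beta.
  exact: (sl2_beta scaleAr sl2_HE sl2_HF sl2_EF sc_i_sqr (sc_comm _)).
have Jg : J (sharp (rgamma R)).
  rewrite sharp_gamma.
  exact: (sl2_gamma scaleAr sl2_HE sl2_HF sl2_EF sc_i_sqr (sc_comm _)).
have Jcomm u v : J (sharp u) -> J (sharp (comm u v)).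
  by rewrite sharp_commutator => ?; apply: in_ideal_comm.
move=> HOm [Hy|[->|[->|->]]]; [|exact: Ja|exact: Jb|].
- case: Hy => [->|[->|[->|[g [->|[->|->]]]]]];
    [| | |exact: (Jcomm _ _ Ja)|exact: (Jcomm _ _ Jb)|exact: (Jcomm _ _ Jg)].
  + rewrite sharp_commAB.
    exact: (sl2_commAB scaleAr sl2_HE sl2_HF sl2_EF sc_i_sqr (sc_comm _)).
  + rewrite sharp_commBC.
    exact: (sl2_commBC scaleAr sl2_HE sl2_HF sl2_EF sc_i_sqr (sc_comm _)).
  + rewrite sharp_commCA.
    exact: (sl2_commCA scaleAr sl2_HE sl2_HF sl2_EF sc_i_sqr (sc_comm _)).
- rewrite sharp_w.
  apply: (sl2_w scaleAr sl2_HE sl2_HF sl2_EF sc_i_sqr (sc_comm _)).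
  case: HOm => [->|[->|->]].
  + by left; apply: sharp_omegaA.
  + by right; left; apply: sharp_omegaB.
  + by right; right; apply: sharp_omegaC.
Qed.

End SharpKernel.

(** * Linear independence *)

Section DifferenceOperators.
Variable K : numFieldType.
Implicit Types (g : K -> K) (l s : K).

(* [Aop], [Bval], [Dop] and [deltaval] are the actions of the images of A, B,
   Delta and delta in the representation E g(s) = g(s + 1),
   F g(s) = (l - s^2) g(s - 1), H g(s) = - (2 s + 1) g(s). *)
Definition Fcoef l s := l - s ^+ 2.

Definition Aop l g s :=
  16%:R^-1 * (g (s + 2%:R) + (Fcoef l (s + 1) + Fcoef l s - 4%:R) * g s
              + Fcoef l s * Fcoef l (s - 1) * g (s - 2%:R)).

Definition Bval s := 16%:R^-1 * ((2%:R * s + 1) ^+ 2 - 4%:R).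

Definition Dop l g s :=
  64%:R^-1 * ((1 - 2%:R * s) * (Fcoef l s * Fcoef l (s - 1)) * g (s - 2%:R)
              + (2%:R * s + 3%:R) * g (s + 2%:R)).

Definition deltaval l := 16%:R^-1 * (4%:R * l - 13%:R).

(** Each [Aop] samples its argument at s + 2, s and s - 2. The vanishing below the top point s + 2k
    passes to [Aop l g] with k lowered by one, so only the top shift survives. *)
Lemma iter_Aop_top l k g s :
  (forall j : nat, g (s + 2%:R * k%:R - 2%:R * j.+1%:R) = 0) ->
  iter k (Aop l) g s = 16%:R^-1 ^+ k * g (s + 2%:R * k%:R).
Proof.
elim: k g => [|k IHk] g g0; first by rewrite mul1r mulr0 addr0.
have Ag0 (j : nat) : Aop l g (s + 2%:R * k%:R - 2%:R * j.+1%:R) = 0.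
  have := g0 j; have := g0 j.+1; have := g0 j.+2; rewrite /Aop.
  rewrite (_ : s + 2%:R * k.+1%:R - 2%:R * j.+1%:R
             = s + 2%:R * k%:R - 2%:R * j.+1%:R + 2%:R); last by ring.
  rewrite (_ : s + 2%:R * k.+1%:R - 2%:R * j.+2%:R
             = s + 2%:R * k%:R - 2%:R * j.+1%:R); last by ring.
  rewrite (_ : s + 2%:R * k.+1%:R - 2%:R * j.+3%:R
             = s + 2%:R * k%:R - 2%:R * j.+1%:R - 2%:R); last by ring.
  by move=> -> -> ->; rewrite !mulr0 !addr0 mulr0.
rewrite iterSr IHk // /Aop exprSr -[RHS]mulrA; congr (_ * (_ * _)).
have := g0 0%N; have := g0 1%N.
rewrite (_ : s + 2%:R * k.+1%:R - 2%:R * 1 = s + 2%:R * k%:R); last by ring.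
rewrite (_ : s + 2%:R * k.+1%:R - 2%:R * 2%:R = s + 2%:R * k%:R - 2%:R); last by ring.
move=> -> ->; rewrite !mulr0 !addr0; congr g; ring.
Qed.

End DifferenceOperators.

(** * Vanishing criteria for polynomials in two variables *)

Lemma poly_eq0_inf_roots (D : idomainType) (p : {poly D}) (f : nat -> D) :
  injective f -> (forall n, p.[f n] = 0) -> p = 0.
Proof.
move=> f_inj pf0; apply: (@roots_geq_poly_eq0 _ _ (mkseq f (size p))).
- by apply/allP => _ /mapP[n _ ->]; apply/eqP.
- by rewrite map_inj_uniq ?iota_uniq.
- by rewrite size_mkseq.
Qed.

Section TwoVariables.
Variable K : numFieldType.
Implicit Types p q : {poly {poly K}}.

(** The inner variable, with value x, stands for delta and the outer one, with value y, for B. *)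
Definition eval2 p (x y : K) : K := p.[y%:P].[x].

Lemma Bval_nat_inj : injective (fun n : nat => Bval (n%:R : K)).
Proof.
move=> m n; rewrite /Bval => h.
have {h} : (2%:R * m%:R + 1 : K) ^+ 2 = (2%:R * n%:R + 1) ^+ 2.
  have : 16%:R * (16%:R^-1 * ((2%:R * m%:R + 1 : K) ^+ 2 - 4%:R)) =
         16%:R * (16%:R^-1 * ((2%:R * n%:R + 1) ^+ 2 - 4%:R)) by rewrite h.
  by rewrite !mulVKf ?pnatr_eq0 // => /addIr.
move=> /eqP; rewrite -!natrM !natr1 -!natrX eqr_nat eqn_exp2r // eqSS eqn_pmul2l // => /eqP.
exact.
Qed.

Lemma eval2_eq0 p :
  (forall x n, eval2 p x (Bval n%:R) = 0) -> p = 0.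
Proof.
move=> p0; apply: (@poly_eq0_inf_roots _ _ (fun n => (Bval n%:R)%:P)).
  by move=> m n /polyC_inj; apply: Bval_nat_inj.
move=> n; apply: (@poly_eq0_inf_roots _ _ (fun m => m%:R)) => [m m'|m].
  by move/eqP; rewrite eqr_nat => /eqP.
exact: p0.
Qed.

(* The reflection s -> -1 - s fixes [Bval s] and changes the sign of 2s + 1. *)
Lemma eval2_parity p q :
  (forall x s, eval2 p x (Bval s) + (2%:R * s + 3%:R) * eval2 q x (Bval s) = 0) ->
  p = 0 /\ q = 0.
Proof.
move=> h.
have q0 : q = 0.
  apply: eval2_eq0 => x n; have h1 := h x n%:R; have := h x (- 1 - n%:R).
  rewrite [Bval (- 1 - _)](_ : _ = Bval n%:R); last by rewrite /Bval; ring.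
  move=> h2; set v := eval2 q _ _ in h1 h2 *; set u := eval2 p _ _ in h1 h2.
  (* Subtract the equations at n and at -1 - n: the factor 2s + 3 takes the values 2n + 3 and 1 -
     2n, which differ by the nonzero 2(2n + 1). *)
  have : 2%:R * (2%:R * n%:R + 1) * v = 0.
    by rewrite -[RHS](subrr 0) -{1}h1 -h2; ring.
  move/eqP; rewrite -natrM natr1 -natrM mulf_eq0 pnatr_eq0 /=.
  by move/eqP.
split=> //; apply: eval2_eq0 => x n.
by have := h x n%:R; rewrite q0 [eval2 0 _ _](_ : _ = 0) ?mulr0 ?addr0 // /eval2 !horner0.
Qed.

End TwoVariables.

(** * Independence of the normal-form monomials as operators *)

Section Independence.
Variable K : numFieldType.
Local Notation term := (K * (nat * nat * bool * nat))%type.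
Implicit Types (p : term) (t : seq term).

Definition term_poly p : {poly {poly K}} :=
  let: (i, j, _, _) := p.2 in (p.1 *: 'X^i) *: 'X^j.

Definition coef_poly t (l : bool) (k : nat) : {poly {poly K}} :=
  \sum_(p <- t | (p.2.1.2 == l) && (p.2.2 == k)) term_poly p.

Definition nf_op (l : bool) (k : nat) (la : K) g s : K :=
  if l then Dop la (iter k (Aop la) g) s else iter k (Aop la) g s.

Arguments nf_op : simpl never.

Definition term_op p la g s : K :=
  let: (i, j, l, k) := p.2 in
  p.1 * deltaval la ^+ i * Bval s ^+ j * nf_op l k la g s.

Lemma eval2_sum (J : Type) (r : seq J) (Q : pred J) (G : J -> {poly {poly K}}) x y :
  eval2 (\sum_(i <- r | Q i) G i) x y = \sum_(i <- r | Q i) eval2 (G i) x y.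
Proof. by rewrite /eval2 !horner_sum. Qed.

Lemma big_regroup (M : nmodType) t n (G : term -> M) :
  (forall p, p \in t -> (p.2.2 < n)%N) ->
  \sum_(p <- t) G p =
  \sum_(k < n) (\sum_(p <- t | (p.2.1.2 == false) && (p.2.2 == k)) G p
                + \sum_(p <- t | (p.2.1.2 == true) && (p.2.2 == k)) G p).
Proof.
elim: t => [|p t IHt] tn.
  by rewrite big_nil big1 // => k _; rewrite !big_nil addr0.
rewrite big_cons {}IHt => [|q qt]; last by apply: tn; rewrite inE qt orbT.
have pn : (p.2.2 < n)%N by apply: tn; rewrite inE eqxx.
rewrite (bigD1 (Ordinal pn)) //= [RHS](bigD1 (Ordinal pn)) //= addrA; congr (_ + _).
  rewrite !big_cons eqxx /= !andbT; case: p.2.1.2 => /=; last by rewrite addrA.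
  by rewrite addrCA.
apply: eq_bigr => k kp; rewrite !big_cons.
have -> : (p.2.2 == k) = false.
  by apply: contraNF kp => /eqP e; apply/eqP/val_inj.
by rewrite !andbF.
Qed.

Lemma sum_term_op t n la g s : (forall p, p \in t -> (p.2.2 < n)%N) ->
  \sum_(p <- t) term_op p la g s =
  \sum_(k < n)
    (eval2 (coef_poly t false k) (deltaval la) (Bval s) * nf_op false k la g s
     + eval2 (coef_poly t true k) (deltaval la) (Bval s) * nf_op true k la g s).
Proof.
move=> tn; rewrite (big_regroup _ tn); apply: eq_bigr => k _.
congr (_ + _); rewrite eval2_sum mulr_suml; apply: eq_bigr;
  move=> [c [[[i j] l'] k']] /= /andP[/eqP-> /eqP->];
  by rewrite /term_op /eval2 /= hornerZ hornerXn -polyC_exp hornerM hornerZ hornerXn hornerC.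
Qed.

Lemma coef_poly_large t n l k : (forall p, p \in t -> (p.2.2 < n)%N) ->
  (n <= k)%N -> coef_poly t l k = 0.
Proof.
move=> tn nk; rewrite /coef_poly big_seq_cond big1 // => p.
by case/and3P => /tn pn _ /eqP e; move: pn; rewrite e ltnNge nk.
Qed.

Definition indicator (z s : K) : K := (s == z)%:R.

Lemma indicator_shift (s : K) (m k : nat) :
  indicator (s + 2%:R * m%:R) (s + 2%:R * k%:R) = (k == m)%:R.
Proof.
rewrite /indicator (inj_eq (addrI s)) (inj_eq (mulfI _)) ?pnatr_eq0 //.
by rewrite eqr_nat.
Qed.

Lemma iter_Aop_indicator la (s : K) (m k : nat) : (k <= m)%N ->
  iter k (Aop la) (indicator (s + 2%:R * m%:R)) s = 16%:R^-1 ^+ k * (k == m)%:R.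
Proof.
move=> km; rewrite iter_Aop_top ?indicator_shift // => j.
rewrite /indicator -addrA (inj_eq (addrI s)) -mulrBr (inj_eq (mulfI _)) ?pnatr_eq0 //.
rewrite subr_eq -natrD eqr_nat; case: eqP => // e.
by move: km; rewrite e addnS ltnNge leq_addr.
Qed.

Lemma nf_op_indicator (l : bool) la (s : K) (m k : nat) : (k + l <= m)%N ->
  nf_op l k la (indicator (s + 2%:R * m%:R)) s =
  (if l then 64%:R^-1 * (2%:R * s + 3%:R) else 1) * (16%:R^-1 ^+ k * ((k + l)%N == m)%:R).
Proof.
case: l => /=; last first.
  by rewrite addn0 mul1r; apply: iter_Aop_indicator.
rewrite addn1 => km; rewrite /nf_op /Dop.
case: m km => // m km.
(* [Dop] samples at s + 2 and s - 2. Seen from there the support of the test function lies m and m +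
   2 double steps ahead; since k <= m, the second value is zero. *)
have -> : s + 2%:R * m.+1%:R = s + 2%:R + 2%:R * m%:R by ring.
rewrite (@iter_Aop_indicator la (s + 2%:R) m k km) eqSS.
have -> : s + 2%:R + 2%:R * m%:R = s - 2%:R + 2%:R * m.+2%:R by ring.
rewrite iter_Aop_indicator; last by rewrite ltnW // ltnW.
by rewrite [k == m.+2](_ : _ = false) ?mulr0 ?add0r ?mulrA // ltn_eqF // ltnW.
Qed.

Lemma eval2Z (c : K) q x y : eval2 (c%:P *: q) x y = c * eval2 q x y.
Proof. by rewrite /eval2 hornerZ hornerM hornerC. Qed.

Lemma deltaval_surj (x : K) : exists la, deltaval la = x.
Proof. by exists (4%:R^-1 * (16%:R * x + 13%:R)); rewrite /deltaval; field. Qed.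

(* Testing against the indicator of s + 2m isolates the coefficient of the
   highest shift, to which only the monomials with k + l = m contribute. *)
Lemma coef_poly_top t n m : (forall p, p \in t -> (p.2.2 < n)%N) -> (m < n)%N ->
  (forall la g s, \sum_(p <- t) term_op p la g s = 0) ->
  (forall (l : bool) k, (m < k + l)%N -> coef_poly t l k = 0) ->
  forall (l : bool) k, (k + l)%N = m -> coef_poly t l k = 0.
Proof.
move=> tn mn op0 c0.
pose z : K := 16%:R^-1; pose z' : K := 64%:R^-1.
pose P := (z ^+ m)%:P *: coef_poly t false m.
(* [z] and [z'] are the constants in the leading shifts of A and Delta. The factor [(0 < m)%N%:R]
   removes this term at m = 0, where [m.-1] defaults to 0 and no Delta A^k has total shift zero. *)
pose Q := ((0 < m)%N%:R * (z' * z ^+ m.-1))%:P *: coef_poly t true m.-1.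
have e0 x y : eval2 0 x y = 0 :> K by rewrite /eval2 !horner0.
have [P0 Q0] : P = 0 /\ Q = 0.
  apply: eval2_parity => x s; have [la <-] := deltaval_surj x.
  set y := deltaval la; set b := Bval s.
  have := op0 la (indicator (s + 2%:R * m%:R)) s; rewrite (sum_term_op _ _ _ tn).
  (* Only (k, l) = (m, 0) and (m - 1, 1) survive: a larger k + l has zero coefficient by hypothesis,
     a smaller one does not reach the test point. They give the value of P and 2s + 3 times that of
     Q. *)
  rewrite -/y -/b => <-; rewrite big_split /=; congr (_ + _).
    rewrite (bigD1 (Ordinal mn)) //= big1 => [|k km].
      rewrite addr0 nf_op_indicator ?addn0 // eqxx mulr1 mul1r.
      by rewrite eval2Z mulrC.
    have {}km : (k : nat) != m by apply: contraNneq km => e; apply/eqP/val_inj.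
    have [lt_km|lt_mk|e] := ltngtP k m; last by rewrite e eqxx in km.
      by rewrite nf_op_indicator addn0 ?(ltnW lt_km) // (negbTE km) !mulr0.
    by rewrite c0 ?addn0 // e0 mul0r.
  rewrite eval2Z; case: m mn c0 @P @Q => [|m] mn c0 P Q.
    rewrite mul0r mul0r mulr0 big1 // => k _.
    by rewrite c0 ?addn1 // e0 mul0r.
  rewrite (bigD1 (Ordinal (ltnW mn))) //= big1 => [|k km].
    rewrite addr0 nf_op_indicator ?addn1 // eqxx mulr1 mul1r.
    by rewrite -/z -/z'; ring.
  have {}km : (k : nat) != m by apply: contraNneq km => e; apply/eqP/val_inj.
  have [lt_km|lt_mk|e] := ltngtP k m; last by rewrite e eqxx in km.
    by rewrite nf_op_indicator addn1 ?ltnS ?(ltnW lt_km) // eqSS (negbTE km) !mulr0.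
  by rewrite c0 ?addn1 // e0 mul0r.
have zn0 j : z ^+ j != 0 by rewrite expf_neq0 // invr_neq0 // pnatr_eq0.
case=> k.
  rewrite addn1 => km; move/eqP: Q0; rewrite /Q -km /= mul1r.
  rewrite -mul_polyC mulf_eq0 !polyC_eq0 mulf_eq0 (negbTE (zn0 _)) orbF.
  by rewrite invr_eq0 pnatr_eq0 /= => /eqP.
rewrite addn0 => km; move/eqP: P0; rewrite /P -km.
by rewrite -mul_polyC mulf_eq0 !polyC_eq0 (negbTE (zn0 _)) => /eqP.
Qed.

Lemma coef_poly_eq0 t :
  (forall la g s, \sum_(p <- t) term_op p la g s = 0) ->
  forall l k, coef_poly t l k = 0.
Proof.
move=> op0.
pose n := (\max_(p <- t) p.2.2).+1.
have tn p : p \in t -> (p.2.2 < n)%N by move=> pt; rewrite ltnS (leq_bigmax_seq p).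
(* Although k < n, a factor Delta lets k + l reach n. The descending induction on k + l therefore
   starts at n + 1. *)
have tn1 p : p \in t -> (p.2.2 < n.+1)%N by move/tn/ltnW.
suff Z r : (r <= n.+1)%N ->
    forall (l : bool) k, (n.+1 - r <= k + l)%N -> coef_poly t l k = 0.
  by move=> l k; apply: (Z n.+1) => //; rewrite subnn.
elim: r => [_|r IHr rn] l k.
  rewrite subn0 => nk; apply: coef_poly_large tn _.
  by rewrite -ltnS; apply: leq_trans nk _; rewrite -addn1 leq_add2l leq_b1.
rewrite subSS leq_eqVlt => /orP[/eqP e|].
  apply: (coef_poly_top tn1 _ op0 _ (esym e)); first by rewrite ltnS leq_subr.
  by move=> l' k' lt; apply: (IHr (ltnW rn)); rewrite subSn.
by move=> lt; apply: (IHr (ltnW rn)); rewrite subSn.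
Qed.

End Independence.

(** * From zero coefficient polynomials back to normal forms *)

Section NormalFormVanishing.
Variables (K : numFieldType) (T : lalgType K) (a b d e : T).

(** [inner] substitutes delta and [outer] then substitutes B. Additivity is the property used of
    them, as [e] and [b] need not commute. *)
Let inner (q : {poly K}) : T := (map_poly (in_alg T) q).[e].

Lemma inner_is_zmod_morphism : zmod_morphism inner.
Proof. by move=> p q; rewrite /inner rmorphB hornerD hornerN. Qed.

HB.instance Definition _ :=
  GRing.isZmodMorphism.Build {poly K} T inner inner_is_zmod_morphism.

Let outer (p : {poly {poly K}}) : T := (map_poly inner p).[b].

Lemma outer_term c i j : outer ((c *: 'X^i) *: 'X^j) = c *: (e ^+ i * b ^+ j).
Proof.
have innerX : inner (c *: 'X^i) = c *: e ^+ i.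
  by rewrite /inner map_polyZ map_polyXn hornerZ hornerXn /= mulr_algl.
have -> : outer ((c *: 'X^i) *: 'X^j) = (inner (c *: 'X^i) *: 'X^j).[b].
  congr (_.[b]); apply/polyP => k; rewrite coef_map !coefZ !coefXn.
  by case: eqP => _; rewrite ?mulr1 // !mulr0 raddf0.
by rewrite innerX hornerZ hornerXn scalerAl.
Qed.

Lemma outer_sum (J : Type) (r : seq J) (Q : pred J) (G : J -> {poly {poly K}}) :
  outer (\sum_(i <- r | Q i) G i) = \sum_(i <- r | Q i) outer (G i).
Proof. by rewrite /outer raddf_sum horner_sum. Qed.

(** A list may repeat monomials, but its sum depends only on the coefficient polynomials; the
    equality holds in [T] itself, not just modulo an ideal. *)
Lemma nf_sum_eq0 t : (forall l k, coef_poly t l k = 0) -> nf_sum a b d e t = 0.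
Proof.
move=> t0; pose n := (\max_(p <- t) p.2.2).+1.
have tn p : p \in t -> (p.2.2 < n)%N by move=> pt; rewrite ltnS (leq_bigmax_seq p).
rewrite /nf_sum (big_regroup _ tn) big1 // => k _.
have grp (l : bool) :
    \sum_(p <- t | (p.2.1.2 == l) && (p.2.2 == k)) p.1 *: nf_monom a b d e p.2
    = outer (coef_poly t l k) * ((if l then d else 1) * a ^+ k).
  rewrite outer_sum mulr_suml; apply: eq_bigr => -[c [[[i j] l'] k']] /=.
  by case/andP => /eqP-> /eqP->; rewrite /term_poly outer_term -scalerAl -mulrA.
by rewrite !grp !t0 /outer raddf0 horner0 !mul0r addr0.
Qed.

End NormalFormVanishing.

(** * Difference operators computed for an abstract action *)

Section ActionFormulas.
Variables (K : numFieldType) (T : lalgType K) (act : T -> (K -> K) -> K -> K).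
Hypothesis actD : forall x y g s, act (x + y) g s = act x g s + act y g s.
Hypothesis actN : forall x g s, act (- x) g s = - act x g s.
Hypothesis actM : forall x y g s, act (x * y) g s = act x (act y g) s.
Hypothesis actZ : forall c x g s, act (c *: x) g s = c * act x g s.
Hypothesis act1 : forall g s, act 1 g s = g s.

Lemma act_nat n g s : act n%:R g s = n%:R * g s.
Proof. by rewrite -scaler_nat actZ act1. Qed.

Section Sl2.
Variables (E F H i_ : T) (l im : K).
Hypothesis actE : forall g s, act E g s = g (s + 1).
Hypothesis actF : forall g s, act F g s = Fcoef l s * g (s - 1).
Hypothesis actH : forall g s, act H g s = - (2%:R * s + 1) * g s.
Hypothesis acti : forall g s, act i_ g s = im * g s.
Hypothesis im2 : im ^+ 2 = - 1.

Let actS := (actD, actN, actM, actZ, act1, act_nat, actE, actF, actH, acti,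
             subrK, addrK).

Lemma act_sl2_HE g s : act (H * E - E * H - 2%:R * E) g s = 0.
Proof. by rewrite !actS; ring. Qed.

Lemma act_sl2_HF g s : act (H * F - F * H + 2%:R * F) g s = 0.
Proof. by rewrite !actS; ring. Qed.

Lemma act_sl2_EF g s : act (E * F - F * E - H) g s = 0.
Proof. by rewrite !actS /Fcoef; ring. Qed.

Let shift2 (s : K) : s + 1 + 1 = s + 2%:R. Proof. by ring. Qed.
Let shiftN2 (s : K) : s - 1 - 1 = s - 2%:R. Proof. by ring. Qed.

Lemma act_sA g s : act (sA E F) g s = Aop l g s.
Proof. by rewrite /sA !actS ?shift2 ?shiftN2 /Aop /Fcoef; ring. Qed.

Lemma act_sB g s : act (sB H) g s = Bval s * g s.
Proof. by rewrite /sB !actS /Bval; ring. Qed.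

Lemma act_sD g s : act (sD E F H) g s = Dop l g s.
Proof. by rewrite /sD !expr2 !actS ?shift2 ?shiftN2 /Dop /Fcoef; ring. Qed.

Lemma act_sC g s :
  act (sC E F i_) g s =
  - 16%:R^-1 * (g (s + 2%:R) - (Fcoef l (s + 1) + Fcoef l s - 4%:R) * g s
                + Fcoef l s * Fcoef l (s - 1) * g (s - 2%:R)).
Proof.
rewrite /sC !actS ?shift2 ?shiftN2 /Fcoef; move: im2.
set u := g (s + 2%:R); set v := g (s - 2%:R); set u1 := g (s + 1); set v1 := g (s - 1).
move=> h; apply/eqP; rewrite -subr_eq0; apply/eqP.
(* The two sides differ by (im^2 + 1)/16 times (E - F)^2 applied to g. *)
transitivity (16%:R^-1 * (im ^+ 2 + 1) *
  (u - (l - (s + 1) ^+ 2 + (l - s ^+ 2)) * g s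
   + (l - s ^+ 2) * (l - (s - 1) ^+ 2) * v)); first by ring.
by rewrite h addNr mulr0 mul0r.
Qed.

(** The shifts by 2 and -2 cancel between A and C, and the remaining quadratic in s cancels against
    [Bval s]. *)
Lemma act_delta g s :
  act (delta_expr (sA E F) (sB H) (sC E F i_)) g s = deltaval l * g s.
Proof.
rewrite /delta_expr !actD act_sA act_sB act_sC /Aop /Bval /deltaval /Fcoef.
by field.
Qed.

End Sl2.

Section NormalForm.
Variables (a b d e : T) (la : K).
Hypothesis act_a : forall g s, act a g s = Aop la g s.
Hypothesis act_b : forall g s, act b g s = Bval s * g s.
Hypothesis act_d : forall g s, act d g s = Dop la g s.
Hypothesis act_e : forall g s, act e g s = deltaval la * g s.

Lemma act_nf_term p g s :
  act (p.1 *: nf_monom a b d e p.2) g s = term_op p la g s.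
Proof.
case: p => c [[[i j] l] k]; rewrite actZ /nf_monom /term_op /= actM.
have act_ei f : act (e ^+ i) f s = deltaval la ^+ i * f s.
  by elim: i => [|i IHi]; rewrite ?act1 ?mul1r // exprS actM act_e IHi mulrA -exprS.
have act_bj f : act (b ^+ j) f s = Bval s ^+ j * f s.
  by elim: j => [|j IHj]; rewrite ?act1 ?mul1r // exprS actM act_b IHj mulrA -exprS.
have act_ak f : act (a ^+ k) f = iter k (Aop la) f.
  elim: k => [|k IHk]; first by apply/funext => r; rewrite act1.
  by apply/funext => r; rewrite exprS actM act_a IHk.
rewrite act_ei actM act_bj !mulrA actM act_ak; congr (_ * _).
by case: l; rewrite (act_d, act1).
Qed.

Lemma act_nf_sum t g s :
  act (nf_sum a b d e t) g s = \sum_(p <- t) term_op p la g s.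
Proof.
rewrite /nf_sum; elim: t => [|p t IHt].
  by rewrite !big_nil -(scale0r 0) actZ mul0r.
by rewrite !big_cons actD IHt act_nf_term.
Qed.

End NormalForm.
End ActionFormulas.

(** * The representation of U(sl2) on functions of a complex variable *)

Section ShiftRepresentation.
Variables (R : realType) (l : CC R).
Local Notation C := (CC R).
Local Notation V := (C -> C^o).

Definition shiftE (g : V) : V := fun s => g (s + 1).
Definition shiftF (g : V) : V := fun s => Fcoef l s * g (s - 1).
Definition shiftH (g : V) : V := fun s => - (2%:R * s + 1) * g s.

Lemma shiftE_is_linear : linear shiftE.
Proof. by []. Qed.

Lemma fun_mul_linear (q : C -> C) (r : C -> C) :
  linear (fun g : V => (fun s => q s * g (r s)) : V).
Proof.
by move=> c u v; apply/funext => s; rewrite /= mulrDr mulrCA.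
Qed.

HB.instance Definition _ := GRing.isLinear.Build C V V _ shiftE shiftE_is_linear.
HB.instance Definition _ := GRing.isLinear.Build C V V _ shiftF
  (fun_mul_linear (Fcoef l) (fun s => s - 1)).
HB.instance Definition _ := GRing.isLinear.Build C V V _ shiftH
  (fun_mul_linear (fun s => - (2%:R * s + 1)) id).

Definition shift_op (i : 'I_3) : {linear V -> V} :=
  match val i with
  | 0%N => (shiftE : {linear V -> V})
  | 1%N => (shiftF : {linear V -> V})
  | _ => (shiftH : {linear V -> V})
  end.

Definition sl2_act (x : FA R 3) (g : C -> C) (s : C) : C :=
  fa_act shift_op x g s.

Lemma sl2_actD x y g s : sl2_act (x + y) g s = sl2_act x g s + sl2_act y g s.
Proof. by rewrite /sl2_act fa_actD. Qed.

Lemma sl2_actN x g s : sl2_act (- x) g s = - sl2_act x g s.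
Proof. by rewrite /sl2_act fa_actN. Qed.

Lemma sl2_actM x y g s : sl2_act (x * y) g s = sl2_act x (sl2_act y g) s.
Proof. by rewrite /sl2_act fa_actM. Qed.

Lemma sl2_actZ c x g s : sl2_act (c *: x) g s = c * sl2_act x g s.
Proof. by rewrite /sl2_act fa_actZ. Qed.

Lemma sl2_act1 g s : sl2_act 1 g s = g s.
Proof. by rewrite /sl2_act fa_act1. Qed.

Lemma sl2_actE g s : sl2_act (uE R) g s = g (s + 1).
Proof. by rewrite /sl2_act fa_act_gen. Qed.

Lemma sl2_actF g s : sl2_act (uF R) g s = Fcoef l s * g (s - 1).
Proof. by rewrite /sl2_act fa_act_gen. Qed.

Lemma sl2_actH g s : sl2_act (uH R) g s = - (2%:R * s + 1) * g s.
Proof. by rewrite /sl2_act fa_act_gen. Qed.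

Lemma sl2_act_sc c g s : sl2_act (sc c) g s = c * g s.
Proof. by rewrite /sc sl2_actZ sl2_act1. Qed.

Lemma sl2_act_ideal x g s : in_ideal (@sl2_rel R) x -> sl2_act x g s = 0.
Proof.
move=> Jx; rewrite /sl2_act (fa_act_ideal _ _ Jx) // => y u.
move=> [->|[->|->]]; apply/funext => r.
- exact: (act_sl2_HE sl2_actD sl2_actN sl2_actM sl2_actZ sl2_act1 sl2_actE sl2_actH).
- exact: (act_sl2_HF sl2_actD sl2_actN sl2_actM sl2_actZ sl2_act1 sl2_actF sl2_actH).
- exact: (act_sl2_EF sl2_actD sl2_actN sl2_actM sl2_actE sl2_actF sl2_actH).
Qed.

End ShiftRepresentation.

(** * The kernel of [sharp] *)

Section Kernel.
Variables (R : realType) (Om : FA R 4).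
Hypothesis casimir_Om : is_casimir Om.
Local Notation C := (CC R).

Definition ker_gens (y : FA R 4) :=
  racah_rel y \/ y = ralpha R \/ y = rbeta R \/ y = omega_elt Om.
Local Notation I := (in_ideal ker_gens).
Local Notation nf := (has_nf ker_gens (rA R) (rB R) (rD R) (rdelta R)).

Lemma rC_delta : rC R = rdelta R - rA R - rB R.
Proof. exact: add3K. Qed.

Lemma nf_closed x : nf x ->
  [/\ nf (rA R * x), nf (rB R * x), nf (rC R * x) & nf (rD R * x)].
Proof.
apply: (racah_nf_closed (@FA_scalerAr R 4) rC_delta _ _ _ _ _ casimir_Om).
- by apply: in_ideal_gen; left; left.
- by apply: in_ideal_gen; left; right; left.
- by apply: in_ideal_gen; left; right; right; left.
- by apply: in_ideal_gen; right; left.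
- by apply: in_ideal_gen; right; right; left.
- by apply: in_ideal_gen; right; right; right.
Qed.

Lemma gen4P (i : 'I_4) :
  [\/ gen R i = rA R, gen R i = rB R, gen R i = rC R | gen R i = rD R].
Proof.
case: i => [[|[|[|[|//]]]] lt_i];
  [constructor 1|constructor 2|constructor 3|constructor 4];
  by congr gen; apply: val_inj.
Qed.

(** Normal forms are stable under left multiplication by each generator, so a word is built up
    letter by letter from its right end. *)
Lemma nf_all x : nf x.
Proof.
rewrite [x]malg_sumE; elim/big_ind: _ => [|y z|w _].
- exact: has_nf0.
- exact: has_nfD.
apply: has_nfZ; rewrite monomE; elim: (fmonom_val w) => [|i s IHs].
  by rewrite big_nil; apply: has_nf1.
rewrite big_cons; have [h1 h2 h3 h4] := nf_closed IHs.
by case: (gen4P i) => ->.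
Qed.

Lemma sharp_ideal x : I x -> in_ker_sharp x.
Proof.
apply: (@in_ideal_rmorphism _ _ (fa_subst (@sharp_gen R))) => y.
exact: sharp_relations_in_ideal.
Qed.

Local Notation act4 la := (fun x => sl2_act la (fa_subst (@sharp_gen R) x)).

(** The action is pulled back along [sharp] to an action of the free algebra on A, B, C, Delta, to
    which [act_nf_sum] applies. *)
Lemma sharp_nf_sum t la g s :
  sl2_act la (sharp (nf_sum (rA R) (rB R) (rD R) (rdelta R) t)) g s
  = \sum_(p <- t) term_op p la g s.
Proof.
have im2 : ('i : C) ^+ 2 = - 1 by rewrite sqrCi.
have aD := @sl2_actD R la; have aN := @sl2_actN R la; have aM := @sl2_actM R la.
have aZ := @sl2_actZ R la; have a1 := @sl2_act1 R la; have aE := @sl2_actE R la.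
have aF := @sl2_actF R la; have aH := @sl2_actH R la.
apply: (@act_nf_sum _ _ (act4 la)).
- by move=> x y f r; rewrite rmorphD aD.
- by move=> x y f r; rewrite rmorphM aM.
- by move=> c x f r; rewrite fa_substZ aZ.
- by move=> f r; rewrite rmorph1 a1.
- by move=> f r; rewrite -/(sharp _) sharpA; apply: (act_sA aD aN aM aZ a1 aE aF).
- by move=> f r; rewrite -/(sharp _) sharpB; apply: (act_sB aD aN aM aZ a1 aH).
- by move=> f r; rewrite -/(sharp _) sharpD; apply: (act_sD aD aN aM aZ a1 aE aF aH).
- move=> f r; rewrite -/(sharp _) sharp_delta.
  exact: (act_delta aD aN aM aZ a1 aE aF aH (@sl2_act_sc R la 'i) im2).
Qed.

(** A normal form congruent to x is also in the kernel, hence acts by zero for every lambda.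
    Independence makes its coefficient polynomials zero, so x is congruent to 0. *)
Lemma ker_sharp_ideal x : in_ker_sharp x -> I x.
Proof.
move=> Jx; have [t It] := nf_all x.
have Jt : in_ker_sharp (nf_sum (rA R) (rB R) (rD R) (rdelta R) t).
  have := in_idealB Jx (sharp_ideal It).
  congr in_ideal.
  rewrite /sharp -(rmorphB (fa_subst (@sharp_gen R))) opprB addrC subrK.
  by [].
have := It; rewrite nf_sum_eq0 ?subr0 //; apply: coef_poly_eq0 => la g s.
by rewrite -sharp_nf_sum; apply: sl2_act_ideal.
Qed.

End Kernel.

(** * Minimality *)

Section ScalarValues.
Variables (K : numFieldType) (U : lalgType K).

(** Later U is [FA R 0], the free algebra on no generators, that is a copy of the scalars; this
    makes a character an instance of [fa_subst]. *)
Definition scal (x : K^o) : U := x *: 1.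

Lemma scal_is_zmod_morphism : zmod_morphism scal.
Proof. by move=> x y; rewrite /scal scalerBl. Qed.

HB.instance Definition _ :=
  GRing.isZmodMorphism.Build K^o U scal scal_is_zmod_morphism.

Lemma scal_is_monoid_morphism : monoid_morphism scal.
Proof.
by split=> [|x y]; rewrite /scal ?scale1r // -scalerAl mul1r scalerA.
Qed.

HB.instance Definition _ :=
  GRing.isMonoidMorphism.Build K^o U scal scal_is_monoid_morphism.

Lemma scalZ (c : K) (x : K^o) : scal (c *: x) = c *: scal x.
Proof. by rewrite /scal scalerA. Qed.

Lemma scal_eq0 (x : K^o) : scal x = 0 -> x = 0.
Proof. by move/eqP; rewrite scaler_eq0 oner_eq0 orbF => /eqP. Qed.

End ScalarValues.

Section ScalarRacah.
Variable K : numFieldType.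
Implicit Types a b c : K^o.

Ltac unfold_expr :=
  rewrite /w_expr /omegaA_expr /omegaB_expr /omegaC_expr /delta_expr
    /alpha_expr /beta_expr /gamma_expr; rewrite /GRing.scale /=.

(* For a character with b = Delta = 0, put x = a + c and y = a c. The element w
   takes the value - 256 y + 3 (4 x - 3) (4 x + 1) for Omega_A and Omega_C, and
   256 x y + 3 (4 x - 3) (4 x + 1) for Omega_B; it vanishes at
   (x, y) = (0, - 9/256) and (- 1, 63/256) respectively. *)
Definition witness1 : K^o := 16%:R^-1 * 3%:R.
Definition witness2 : K^o := - (16%:R^-1 * 3%:R).
Definition witness3 : K^o := - (16%:R^-1 * 7%:R).
Definition witness4 : K^o := - (16%:R^-1 * 9%:R).

Lemma alpha_scalar a c : alpha_expr a 0 c 0 = a * c.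
Proof. by unfold_expr; ring. Qed.

Lemma beta_scalar b c : beta_expr 0 b c 0 = - (b * c).
Proof. by unfold_expr; ring. Qed.

Lemma beta_scalar0 a c : beta_expr a 0 c 0 = 0.
Proof. by unfold_expr; ring. Qed.

Lemma alpha_scalar0 b c : alpha_expr 0 b c 0 = 0.
Proof. by unfold_expr; ring. Qed.

Lemma wA_alpha :
  w_expr witness1 0 witness2 (omegaA_expr witness1 0 witness2 0) = 0.
Proof. by rewrite /witness1 /witness2; unfold_expr; field. Qed.

Lemma wB_alpha :
  w_expr witness3 0 witness4 (omegaB_expr witness3 0 witness4 0) = 0.
Proof. by rewrite /witness3 /witness4; unfold_expr; field. Qed.

Lemma wC_alpha :
  w_expr witness1 0 witness2 (omegaC_expr witness1 0 witness2 0) = 0.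
Proof. by rewrite /witness1 /witness2; unfold_expr; field. Qed.

(** With a = Delta = 0 the roles rotate: Omega_A equals bc(b + c), while Omega_B and Omega_C equal
    -bc. The two witness pairs are distributed accordingly. *)
Lemma wA_beta :
  w_expr 0 witness3 witness4 (omegaA_expr 0 witness3 witness4 0) = 0.
Proof. by rewrite /witness3 /witness4; unfold_expr; field. Qed.

Lemma wB_beta :
  w_expr 0 witness1 witness2 (omegaB_expr 0 witness1 witness2 0) = 0.
Proof. by rewrite /witness1 /witness2; unfold_expr; field. Qed.

Lemma wC_beta :
  w_expr 0 witness1 witness2 (omegaC_expr 0 witness1 witness2 0) = 0.
Proof. by rewrite /witness1 /witness2; unfold_expr; field. Qed.

Lemma w_zero (om : K^o) : om = omegaA_expr 0 0 0 0 \/ om = omegaB_expr 0 0 0 0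
  \/ om = omegaC_expr 0 0 0 0 -> w_expr 0 0 0 om = - 9%:R.
Proof. by case=> [->|[->|->]]; unfold_expr; field. Qed.

Lemma witness12_neq0 : witness1 * witness2 != 0.
Proof. by rewrite mulf_neq0 ?oppr_eq0 // mulf_neq0 ?invr_eq0 ?pnatr_eq0. Qed.

Lemma witness34_neq0 : witness3 * witness4 != 0.
Proof. by rewrite mulf_neq0 ?oppr_eq0 // mulf_neq0 ?invr_eq0 ?pnatr_eq0. Qed.

Lemma comm_scalar a b : comm a b = 0.
Proof. by rewrite /comm mulrC subrr. Qed.

End ScalarRacah.

(** * One-dimensional representations of the Racah algebra *)

Section Characters.
Variables (R : realType) (a b c : (CC R)^o).
Local Notation U := (FA R 0).

(** Delta must go to 0, because scalars commute and 2 Delta = [A, B]. *)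
Definition char_gen (i : 'I_4) : U :=
  match val i with
  | 0%N => scal U a
  | 1%N => scal U b
  | 2%N => scal U c
  | _ => scal U 0
  end.

Let chi : {rmorphism FA R 4 -> U} := fa_subst char_gen.

Lemma chiZ (z : CC R) x : chi (z *: x) = z *: chi x.
Proof. exact: fa_substZ. Qed.

Lemma chiA : chi (rA R) = scal U a. Proof. exact: fa_subst_gen. Qed.
Lemma chiB : chi (rB R) = scal U b. Proof. exact: fa_subst_gen. Qed.
Lemma chiC : chi (rC R) = scal U c. Proof. exact: fa_subst_gen. Qed.
Lemma chiD : chi (rD R) = scal U 0. Proof. exact: fa_subst_gen. Qed.

Lemma chi_alpha : chi (ralpha R) = scal U (alpha_expr a b c 0).
Proof.
apply: etrans (alpha_exprE chi _ _ _ _) _.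
by rewrite (alpha_exprE (scal U)) chiA chiB chiC chiD.
Qed.

Lemma chi_beta : chi (rbeta R) = scal U (beta_expr a b c 0).
Proof.
apply: etrans (beta_exprE chi _ _ _ _) _.
by rewrite (beta_exprE (scal U)) chiA chiB chiC chiD.
Qed.

Lemma chi_gamma : chi (rgamma R) = scal U (gamma_expr a b c 0).
Proof.
apply: etrans (gamma_exprE chi _ _ _ _) _.
by rewrite (gamma_exprE (scal U)) chiA chiB chiC chiD.
Qed.

Lemma chi_wA :
  chi (omega_elt (OmegaA R)) = scal U (w_expr a b c (omegaA_expr a b c 0)).
Proof.
apply: etrans (w_exprE chi _ _ _ _) _.
rewrite (w_exprE (scal U)) (omegaA_exprE (@scalZ _ U)) chiA chiB chiC; congr w_expr.
apply: etrans (omegaA_exprE chiZ _ _ _ _) _; by rewrite chiA chiB chiC chiD.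
Qed.

Lemma chi_wB :
  chi (omega_elt (OmegaB R)) = scal U (w_expr a b c (omegaB_expr a b c 0)).
Proof.
apply: etrans (w_exprE chi _ _ _ _) _.
rewrite (w_exprE (scal U)) (omegaB_exprE (@scalZ _ U)) chiA chiB chiC; congr w_expr.
apply: etrans (omegaB_exprE chiZ _ _ _ _) _; by rewrite chiA chiB chiC chiD.
Qed.

Lemma chi_wC :
  chi (omega_elt (OmegaC R)) = scal U (w_expr a b c (omegaC_expr a b c 0)).
Proof.
apply: etrans (w_exprE chi _ _ _ _) _.
rewrite (w_exprE (scal U)) (omegaC_exprE (@scalZ _ U)) chiA chiB chiC; congr w_expr.
apply: etrans (omegaC_exprE chiZ _ _ _ _) _; by rewrite chiA chiB chiC chiD.
Qed.

Lemma scal_comm0 x y : comm (scal U x) (scal U y) = 0.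
Proof. by rewrite -(morph_commutator (scal U)) comm_scalar rmorph0. Qed.

Lemma scal_comm_rel x y : scal U x * scal U y - scal U y * scal U x - 2%:R * scal U 0 = 0.
Proof. by rewrite [X in X - _]scal_comm0 rmorph0 mulr0 subr0. Qed.

Lemma chi_racah_rel y : racah_rel y -> chi y = 0.
Proof.
have chi_comm z g : (exists v, chi z = scal U v) -> chi (comm z (gen R g)) = 0.
  move=> [v zv]; rewrite (_ : chi _ = comm (chi z) (chi (gen R g))); last first.
    exact: (morph_commutator chi).
  by rewrite zv; case: (gen4P R g) => ->; rewrite (chiA, chiB, chiC, chiD) scal_comm0.
case=> [->|[->|[->|[g [->|[->|->]]]]]].
- apply: etrans (commB_exprE chi (rA R) (rB R) (rD R)) _.
  by rewrite chiA chiB chiD scal_comm_rel.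
- apply: etrans (commB_exprE chi (rB R) (rC R) (rD R)) _.
  by rewrite chiB chiC chiD scal_comm_rel.
- apply: etrans (commB_exprE chi (rC R) (rA R) (rD R)) _.
  by rewrite chiC chiA chiD scal_comm_rel.
- by apply: chi_comm; eexists; exact: chi_alpha.
- by apply: chi_comm; eexists; exact: chi_beta.
- by apply: chi_comm; eexists; exact: chi_gamma.
Qed.

Lemma character_separates (S : FA R 4 -> Prop) x v :
  (forall y, S y -> racah_rel y \/ chi y = 0) -> chi x = scal U v -> v != 0 ->
  ~ in_ideal S x.
Proof.
move=> chiS xv v0 Ix; move/eqP: v0; apply; apply: (@scal_eq0 _ U); rewrite -xv.
(* The character sends every generator of the ideal to 0, so its image lies in the ideal generated
   by 0. *)
have [t [t0 ->]] : in_ideal (fun u : U => u = 0) (chi x).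
  apply: in_ideal_rmorphism Ix => y /chiS[/chi_racah_rel ->|->];
  exact: in_ideal0.
by rewrite big_seq big1 // => p /t0 ->; rewrite mulr0 mul0r.
Qed.

End Characters.

(* Everything is lifted to the free algebra FA R 4 on A, B, C, Delta:
   the two-sided ideal of Re generated by a set S corresponds to the ideal
   of FA R 4 generated by S together with the defining relations of Re. *)
Theorem theorem1p5 (R : realType) (Om : FA R 4) :
  Om = OmegaA R \/ Om = OmegaB R \/ Om = OmegaC R ->
  let w := omega_elt Om in
  (* alpha, beta, w generate ker sharp *)
  (forall x : FA R 4,
      in_ideal (fun y => racah_rel y \/ y = ralpha R \/ y = rbeta R \/ y = w) x
      <-> in_ker_sharp x) /\
  (* minimality *)
  ~ in_ideal (fun y => racah_rel y \/ y = rbeta R \/ y = w) (ralpha R) /\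
  ~ in_ideal (fun y => racah_rel y \/ y = ralpha R \/ y = w) (rbeta R) /\
  ~ in_ideal (fun y => racah_rel y \/ y = ralpha R \/ y = rbeta R) w.
Proof.
move=> HOm w; split; [|split; [|split]].
- by move=> x; split; [apply: sharp_ideal|apply: ker_sharp_ideal].
(* Alpha is separated by a character with b = 0: it kills beta, sends alpha to ac, and the witnesses
   make w vanish. *)
- have [a [c [ac0 wac]]] : exists a c : (CC R)^o, a * c != 0 /\
      fa_subst (char_gen a 0 c) w = 0.
    rewrite /w; case: HOm => [->|[->|->]].
    + exists (witness1 _), (witness2 _); split; first exact: witness12_neq0.
      by rewrite chi_wA wA_alpha /scal scale0r.
    + exists (witness3 _), (witness4 _); split; first exact: witness34_neq0.
      by rewrite chi_wB wB_alpha /scal scale0r.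
    + exists (witness1 _), (witness2 _); split; first exact: witness12_neq0.
      by rewrite chi_wC wC_alpha /scal scale0r.
  apply: (@character_separates R a 0 c _ _ (a * c)) ac0.
    move=> y [|[->|->]]; [by left|right|by right].
    by rewrite chi_beta beta_scalar0 /scal scale0r.
  by rewrite chi_alpha alpha_scalar.
(* Beta is separated by a character with a = 0: it kills alpha and sends beta to -bc. *)
- have [b [c [bc0 wbc]]] : exists b c : (CC R)^o, - (b * c) != 0 /\
      fa_subst (char_gen 0 b c) w = 0.
    rewrite /w; case: HOm => [->|[->|->]].
    + exists (witness3 _), (witness4 _); split; first by rewrite oppr_eq0 witness34_neq0.
      by rewrite chi_wA wA_beta /scal scale0r.
    + exists (witness1 _), (witness2 _); split; first by rewrite oppr_eq0 witness12_neq0.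
      by rewrite chi_wB wB_beta /scal scale0r.
    + exists (witness1 _), (witness2 _); split; first by rewrite oppr_eq0 witness12_neq0.
      by rewrite chi_wC wC_beta /scal scale0r.
  apply: (@character_separates R 0 b c _ _ (- (b * c))) bc0.
    move=> y [|[->|->]]; [by left|right|by right].
    by rewrite chi_alpha alpha_scalar0 /scal scale0r.
  by rewrite chi_beta beta_scalar.
(* The zero character kills alpha and beta, and leaves of w the constant term 3(-3)(1) = -9. *)
- apply: (@character_separates R 0 0 0 _ _ (- 9%:R)).
  + move=> y [|[->|->]]; [by left|right|right].
      by rewrite chi_alpha alpha_scalar0 /scal scale0r.
    by rewrite chi_beta beta_scalar0 /scal scale0r.
  + rewrite /w; case: HOm => [->|[->|->]].
    * by rewrite chi_wA w_zero //; left.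
    * by rewrite chi_wB w_zero //; right; left.
    * by rewrite chi_wC w_zero //; right; right.
  + by rewrite oppr_eq0 pnatr_eq0.
Qed.
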